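(* Let $(\sigma_n)_{n\in\mathbb{N}}$ be a convergent permutation sequence with $\lim_{n\to\infty}|\sigma_n|=\infty$. Then there exists a limit permutation $Z:[0,1]^2\to[0,1]$ such that $$\lim_{n\to\infty}t(\tau,\sigma_n)=t(\tau,Z)\quad\text{for every permutation }\tau.$$ Conversely, every limit permutation $Z:[0,1]^2\to[0,1]$ is a limit of a convergent permutation sequence, i.e. there is a permutation sequence $(\sigma_n)_{n\in\mathbb{N}}$ with $\lim_{n\to\infty}t(\tau,\sigma_n)=t(\tau,Z)$ for every permutation $\tau$.
   Context: A permutation is a bijection $\sigma:[n]\to[n]$, $[n]=\{1,\dots,n\}$, $n\ge1$; $|\sigma|=n$ is its length. For a totally ordered set $A$, $A^m_<$ denotes the set of strictly increasing $m$-tuples of elements of $A$. Subpermutation density: for permutations $\tau$ of $[k]$ and $\pi$ of $[n]$, $\Lambda(\tau,\pi)$ is the number of $(x_1,\dots,x_k)\in[n]^k_<$ such that, for all $i,j$, $\pi(x_i)<\pi(x_j)$ if and only if $\tau(i)<\tau(j)$; $t(\tau,\pi)=\binom nk^{-1}\Lambda(\tau,\pi)$ if $k\le n$, and $t(\tau,\pi)=0$ if $k>n$. A permutation sequence $(\sigma_n)$ is convergent if, for every fixed permutation $\tau$, the real sequence $(t(\tau,\sigma_n))_n$ converges. A cdf is a non-decreasing left-continuous function $F:[0,1]\to[0,1]$ with $F(0)=0$. Its associated measure is the Borel probability measure $\mu_F$ on $[0,1]$ with $\mu_F([0,1])=1$ and $\mu_F([a,b))=F(b)-F(a)$ for $0\le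 a<b\le1$; $\int\cdots dF_1\cdots dF_m$ denotes integration against $\mu_{F_1}\times\cdots\times\mu_{F_m}$. A limit permutation is a Lebesgue measurable function $Z:[0,1]^2\to[0,1]$ such that (a) for every $x\in[0,1]$, $Z(x,\cdot)$ is a cdf, continuous at $0$, with $Z(x,1)=1$; (b) for every $y\in[0,1]$, $\int_0^1Z(x,y)\,dx=y$. For a permutation $\tau$ of $[m]$ and a limit permutation $Z$, $$t(\tau,Z)=m!\int_{[0,1]^m_<}\Big(\int_{[0,1]^m_<}dZ(x_{\tau^{-1}(1)},\cdot)\cdots dZ(x_{\tau^{-1}(m)},\cdot)\Big)dx_1\cdots dx_m,$$ where in the inner integral over $(y_1,\dots,y_m)\in[0,1]^m_<$ the variable $y_i$ is integrated against the measure of the cdf $Z(x_{\tau^{-1}(i)},\cdot)$ (so $t(\tau,Z)=1$ when $m=1$). *)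

(* Defs.v *)
From HB Require Import structures.
From mathcomp Require Import all_boot all_order all_algebra all_fingroup.
From mathcomp Require Import all_classical all_reals all_analysis.
From mathcomp Require Import measurable_realfun.

Set Implicit Arguments.
Unset Strict Implicit.
Unset Printing Implicit Defensive.
Import Order.TTheory GRing.Theory Num.Theory.
Import numFieldNormedType.Exports.

Local Open Scope classical_set_scope.
Local Open Scope ring_scope.

(* [Tagged _ s] with [s : 'S_n.+1] is a permutation of length n.+1, acting on
   the positions 0, ..., n instead of 1, ..., n.+1. *)
Definition permutation : Type := {n : nat & 'S_n.+1}.

Definition plength (s : permutation) : nat := (tag s).+1.

Definition pfun (s : permutation) : 'S_(plength s) := tagged s.

(* The increasing tuples of positions at which pi has the pattern tau. *)
Definition occurrences (tau pi : permutation)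
    : {set (plength tau).-tuple 'I_(plength pi)} :=
  [set x : (plength tau).-tuple 'I_(plength pi) |
     [forall i : 'I_(plength tau), forall j : 'I_(plength tau),
        (i < j)%N ==> (tnth x i < tnth x j)%N] &&
     [forall i : 'I_(plength tau), forall j : 'I_(plength tau),
        (pfun pi (tnth x i) < pfun pi (tnth x j))%N
          == (pfun tau i < pfun tau j)%N]].

Definition density (R : realType) (tau pi : permutation) : R :=
  if (plength tau <= plength pi)%N then
    #|occurrences tau pi|%:R / 'C(plength pi, plength tau)%:R
  else 0.

Definition convergent (R : realType) (sigma : nat -> permutation) : Prop :=
  forall tau, cvgn (fun n => density R tau (sigma n)).

Lemma sigma_finite_prod d1 d2 (T1 : measurableType d1) (T2 : measurableType d2)
    (R : realType) (mu : {sigma_finite_measure set T1 -> \bar R})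
    (nu : {sigma_finite_measure set T2 -> \bar R}) :
  sigma_finite [set: T1 * T2] (mu \x nu)%E.
Proof.
have /sigma_finiteP[F [TF ndF Foo]] := sigma_finiteT mu.
have /sigma_finiteP[G [TG ndG Goo]] := sigma_finiteT nu.
exists (fun n => F n `*` G n) => [|k].
  rewrite -setXTT TF TG predeqE => -[x y]; split.
    move=> [/= [n _ Fnx] [k _ Gky]]; exists (maxn n k) => //; split.
    - by move: x Fnx; exact/subsetPset/ndF/leq_maxl.
    - by move: y Gky; exact/subsetPset/ndG/leq_maxr.
  by move=> [n _ []/= ? ?]; split; exists n.
have [? ?] := Foo k; have [? ?] := Goo k.
split; first exact: measurableX.
by rewrite product_measure1E// lte_mul_pinfty// ge0_fin_numE.
Qed.

(* The product measure mu x nu, transported to tuples along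
   (x, t) |-> x :: t; see [prod_measureE] for boxes. *)
Section prod_measure_cons.
Context d (T : measurableType d) (R : realType) (n : nat).
Variables (mu : {sigma_finite_measure set T -> \bar R})
          (nu : {sigma_finite_measure set (n.-tuple T) -> \bar R}).
Local Open Scope ereal_scope.

Let tcons (p : T * n.-tuple T) : n.+1.-tuple T := [tuple of p.1 :: p.2].

Let measurable_tcons : measurable_fun setT tcons.
Proof. exact: measurable_cons. Qed.

Definition prod_measure_cons : set (n.+1.-tuple T) -> \bar R :=
  pushforward (mu \x nu) tcons.

Let cons0 : prod_measure_cons set0 = 0.
Proof. by rewrite /prod_measure_cons /pushforward preimage_set0 measure0. Qed.

Let cons_ge0 A : 0 <= prod_measure_cons A.
Proof. exact: measure_ge0. Qed.

Let cons_sigma_additive : semi_sigma_additive prod_measure_cons.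
Proof.
exact: (@measure_semi_sigma_additive _ _ _
  (measure_function_pushforward__canonical__measure_function_Measure
     (mu \x nu) measurable_tcons)).
Qed.

HB.instance Definition _ := isMeasure.Build _ _ _ prod_measure_cons
  cons0 cons_ge0 cons_sigma_additive.

Let tuncons (t : n.+1.-tuple T) : T * n.-tuple T :=
  (thead t, [tuple of behead t]).

Let measurable_tuncons : measurable_fun setT tuncons.
Proof.
by apply: measurable_fun_pair; [exact: measurable_tnth|exact: measurable_behead].
Qed.

Let tconsK : cancel tcons tuncons.
Proof.
by move=> [x t]; rewrite /tuncons theadE; congr pair; exact: val_inj.
Qed.

Let cons_tuncons (C : set (T * n.-tuple T)) :
  prod_measure_cons (tuncons @^-1` C) = (mu \x nu) C.
Proof.
rewrite /prod_measure_cons /pushforward -comp_preimage.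
by congr product_measure1; apply/seteqP; split=> p; rewrite /preimage/= tconsK.
Qed.

Lemma prod_measure_consE (A : set T) (B : set (n.-tuple T)) :
  measurable A -> measurable B ->
  prod_measure_cons [set t | A (thead t) /\ B [tuple of behead t]]
    = mu A * nu B.
Proof. by move=> mA mB; rewrite -product_measure1E// -cons_tuncons. Qed.

Let cons_sigma_finite : sigma_finite setT prod_measure_cons.
Proof.
have [F FT mF] := sigma_finite_prod mu nu.
exists (fun k => tuncons @^-1` F k); first by rewrite -preimage_bigcup -FT.
move=> k; have [mFk Fk] := mF k; split; last by rewrite cons_tuncons.
by rewrite -[X in measurable X]setTI; exact: measurable_tuncons.
Qed.

HB.instance Definition _ := Measure_isSigmaFinite.Build _ _ _
  prod_measure_cons cons_sigma_finite.

End prod_measure_cons.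

Section prod_measure.
Context d (T : measurableType d) (R : realType).

Fixpoint prod_measure (n : nat) :
    ('I_n -> {sigma_finite_measure set T -> \bar R}) ->
    {sigma_finite_measure set (n.-tuple T) -> \bar R} :=
  if n is n'.+1 then fun mu =>
    prod_measure_cons (mu ord0) (prod_measure (fun i => mu (lift ord0 i)))
  else fun=> dirac [tuple].

Lemma prod_measureE n (mu : 'I_n -> {sigma_finite_measure set T -> \bar R})
    (A : 'I_n -> set T) : (forall i, measurable (A i)) ->
  prod_measure mu [set t | forall i, A i (tnth t i)]
    = (\prod_(i < n) mu i (A i))%E.
Proof.
elim: n mu A => [|n IHn] mu A mA.
  by rewrite big_ord0 /= diracE mem_set// => -[].
rewrite big_ord_recl -IHn// -prod_measure_consE//.
- rewrite [LHS]/=; congr (prod_measure_cons _ _ _).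
  apply/seteqP; split; case/tupleP=> x t /=.
  + move=> At; split=> [|i]; first by have := At ord0; rewrite tnth0 theadE.
    by have := At (lift ord0 i); rewrite tnthS (_ : [tuple of _] = t)//; exact: val_inj.
  + rewrite theadE => -[A0 AS] i; case: (unliftP ord0 i) => [j ->|->].
      by have := AS j; rewrite tnthS (_ : [tuple of _] = t)//; exact: val_inj.
    by rewrite tnth0.
- rewrite [X in measurable X](_ : _ = \bigcap_(i in [set: 'I_n])
    ((fun t : n.-tuple T => tnth t i) @^-1` A (lift ord0 i))).
    apply: fin_bigcap_measurable => // i _.
    by rewrite -[X in measurable X]setTI; exact: measurable_tnth.
  by apply/seteqP; split=> t At i; [move=> _|]; exact: At.
Qed.

End prod_measure.

Section lebesgue.
Variable R : realType.

Definition borel_lebesgue_tuple (m : nat) :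
    {sigma_finite_measure set (m.-tuple (measurableTypeR R)) -> \bar R} :=
  prod_measure (fun _ : 'I_m => lebesgue_measure).

(* R^m with its sigma-algebra of Lebesgue measurable sets: those that are
   Caratheodory measurable for the outer measure of [borel_lebesgue_tuple]. *)
Definition lebesgue_space (m : nat) :=
  caratheodory_type (borel_lebesgue_tuple m)^*%mu.

Definition lebesgue_tuple (m : nat) :
    {measure set (lebesgue_space m) -> \bar R} :=
  @completed_measure_extension _ _ _ (borel_lebesgue_tuple m).

Definition lebesgue_plane :=
  caratheodory_type (@lebesgue_measure R \x @lebesgue_measure R)%E^*%mu.

(* Only the values of F on `[0, 1] matter. *)
Record cdf (F : R -> R) : Prop := {
  cdf_itv : forall y, 0 <= y <= 1 -> 0 <= F y <= 1;
  cdf_nondecreasing : forall y z, 0 <= y -> y <= z -> z <= 1 -> F y <= F z;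
  cdf_left_continuous : forall y, 0 < y <= 1 -> F z @[z --> y^'-] --> F y;
  cdf0 : F 0 = 0 }.

(* mu is a measure on the whole real line, concentrated on `[0, 1]. *)
Definition is_cdf_measure (F : R -> R) (mu : probability (measurableTypeR R) R) :=
  mu `[0, 1]%classic = 1%E /\
  forall a b, 0 <= a -> a < b -> b <= 1 -> mu `[a, b[%classic = (F b - F a)%:E.

(* The measure [is_cdf_measure] specifies; it exists by [cdf_measureP] below,
   and its values on Borel sets are unique, since the intervals [a, b[ and
   `[0, 1] generate the Borel subsets of `[0, 1]. *)
Definition cdf_measure (F : R -> R) : probability (measurableTypeR R) R :=
  get [set mu : probability (measurableTypeR R) R | is_cdf_measure F mu].

(* Existence: the law of the quantile function of F under the uniform
   distribution on `[0, 1]. *)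
Section cdf_measure_exists.
Variables (F : R -> R) (cdfF : cdf F).

Let A u := [set y : R | 0 <= y <= 1 /\ F y <= u].

Definition quantile (u : R) : R := sup (A u).

Let Q_ub u : ubound (A u) 1.
Proof. by move=> y [/andP[]]. Qed.

Let A0 u : 0 <= u -> A u 0.
Proof. by move=> u0; rewrite /A/= (cdf0 cdfF) lexx ler01. Qed.

Let Q_ge0 u : 0 <= quantile u.
Proof.
have [Ae|/set0P[y Ay]] := eqVneq (A u) set0; first by rewrite /quantile Ae sup0.
have [/andP[y0 _] _] := Ay.
by apply: (le_trans y0); apply: ub_le_sup => //; exists 1; exact: Q_ub.
Qed.

Let Q_le1 u : quantile u <= 1.
Proof.
have [Ae|/set0P A_n0] := eqVneq (A u) set0; first by rewrite /quantile Ae sup0.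
by apply: ge_sup => //; exact: Q_ub.
Qed.

Let quantile_nondecreasing : {homo quantile : u v / u <= v}.
Proof.
move=> u v uv; have [Ae|/set0P A_n0] := eqVneq (A u) set0.
  by rewrite {1}/quantile Ae sup0.
apply: ge_sup => // y [y01 Fyu].
by apply: ub_le_sup; [exists 1; exact: Q_ub|split=> //; exact: le_trans Fyu uv].
Qed.

Let measurable_quantile :
  measurable_fun setT (quantile : measurableTypeR R -> measurableTypeR R).
Proof. exact: nondecreasing_measurable. Qed.

Let quantile_ge u y : 0 <= u -> 0 <= y <= 1 -> (y <= quantile u) = (F y <= u).
Proof.
move=> u0 /andP[y0 y1]; apply/idP/idP => [yQ|Fyu]; last first.
  by apply: ub_le_sup; [exists 1; exact: Q_ub|rewrite /A/= y0 y1].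
rewrite leNgt; apply/negP => uFy.
have {}y0 : 0 < y.
  rewrite lt_neqAle y0 andbT; apply/eqP => y0'.
  by move: uFy; rewrite -y0' (cdf0 cdfF) ltNge u0.
have Fcvg := cdf_left_continuous cdfF (introT andP (conj y0 y1)).
near y^'- => z.
have zy : z < y by near: z; exact: nbhs_left_lt.
have z0 : 0 < z by near: z; exact: nbhs_left_gt.
have uFz : u < F z by near: z; exact: (cvgr_gt (F y)).
move: yQ; apply/negP; rewrite -ltNge (le_lt_trans _ zy)//.
apply: ge_sup; first by exists 0; exact: A0.
move=> x [/andP[x0 x1] Fxu]; rewrite leNgt; apply/negP => zx.
by have := cdf_nondecreasing cdfF (ltW z0) (ltW zx) x1;
  rewrite leNgt (le_lt_trans Fxu).
Unshelve. all: by end_near. Qed.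

HB.instance Definition _ := isMeasurableFun.Build _ _ _ _
  (quantile : measurableTypeR R -> measurableTypeR R) measurable_quantile.

Let unif : probability (measurableTypeR R) R := uniform_prob (@ltr01 R).

Let unifE (U : set (measurableTypeR R)) : measurable U ->
  unif U = lebesgue_measure (U `&` `[0, 1]%classic).
Proof.
move=> mU; rewrite /unif/= /uniform_prob integral_uniform_pdf.
rewrite (eq_integral (cst 1%E)) ?integral_cst ?mul1e//; first exact: measurableI.
move=> x /[!inE]/= -[_]; rewrite in_itv/= /uniform_pdf => ->.
by rewrite subr0 invr1.
Qed.

Let law : probability (measurableTypeR R) R :=
  distribution unif (quantile : measurableTypeR R -> measurableTypeR R).

Let law_cdf : is_cdf_measure F law.
Proof.
split=> [|a b a0 ab b1].
  rewrite -(probability_setT unif) /law/= /distribution /pushforward.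
  congr (unif _); apply/seteqP; split=> // u _.
  by rewrite /= in_itv/= Q_ge0 Q_le1.
have mQ : measurable (quantile @^-1` `[a, b[%classic : set (measurableTypeR R)).
  by rewrite -[X in measurable X]setTI; exact: measurable_quantile.
rewrite /law/= /distribution /pushforward unifE//.
have a01 : 0 <= a <= 1 by rewrite a0 (le_trans (ltW ab)).
have b01 : 0 <= b <= 1 by rewrite b1 (le_trans a0 (ltW ab)).
have /andP[Fa0 _] := cdf_itv cdfF a01; have /andP[_ Fb1] := cdf_itv cdfF b01.
have Fab := cdf_nondecreasing cdfF a0 (ltW ab) b1.
rewrite [X in lebesgue_measure X](_ : _ = `[F a, F b[%classic).
  rewrite lebesgue_measure_itv/= lte_fin; case: ltP => [_|Fba].
    by rewrite EFinB.
  by rewrite (@le_anti _ _ (F a) (F b)) ?Fab ?subrr.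
apply/seteqP; split=> u /=; rewrite !in_itv/=.
  by move=> [/andP[aQ Qb] /andP[u0 u1]];
    rewrite -quantile_ge// aQ ltNge -quantile_ge// -ltNge.
move=> /andP[Fau uFb]; have u0 := le_trans Fa0 Fau.
rewrite quantile_ge// Fau u0 (le_trans (ltW uFb))//; split=> //=.
by rewrite ltNge quantile_ge// -ltNge.
Qed.

Lemma cdf_measureP : is_cdf_measure F (cdf_measure F).
Proof. by rewrite /cdf_measure; apply: (getPex (ex_intro _ law law_cdf)). Qed.

End cdf_measure_exists.

Definition increasing_tuples (m : nat) : set (m.-tuple R) :=
  [set x | (forall i, 0 <= tnth x i <= 1) /\
           (forall i j : 'I_m, (i < j)%N -> tnth x i < tnth x j)].
Arguments increasing_tuples m : clear implicits.

(* Z is a function on the unit square; its values elsewhere are irrelevant. *)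
Record limit_permutation (Z : R -> R -> R) : Prop := {
  limit_permutation_measurable :
    measurable_fun ([set p | 0 <= p.1 <= 1 /\ 0 <= p.2 <= 1] : set lebesgue_plane)
      (fun p => Z p.1 p.2);
  limit_permutation_cdf : forall x, 0 <= x <= 1 -> cdf (Z x);
  limit_permutation_continuous0 : forall x, 0 <= x <= 1 ->
    Z x y @[y --> 0^'+] --> Z x 0;
  limit_permutation1 : forall x, 0 <= x <= 1 -> Z x 1 = 1;
  limit_permutation_uniform : forall y, 0 <= y <= 1 ->
    (\int[@completed_lebesgue_measure R]_(x in `[0%R, 1%R]) (Z x y)%:E = y%:E)%E }.

(* y_i is integrated against the measure of the cdf Z (x_(tau^-1 i)). *)
Definition limit_density (tau : permutation) (Z : R -> R -> R) : R :=
  let m := plength tau in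
  m`!%:R *
  \int[lebesgue_tuple m]_(x in (increasing_tuples m : set (lebesgue_space m)))
    \int[prod_measure (fun i : 'I_m =>
            cdf_measure (Z (tnth (x : m.-tuple R) ((pfun tau)^-1%g i))))]_
      (y in increasing_tuples m) 1.

End lebesgue.

(* Main.v *)
From HB Require Import structures.
Require Import Defs.
From mathcomp Require Import all_boot all_order all_algebra all_fingroup.
From mathcomp Require Import all_classical all_reals all_analysis.
From mathcomp Require Import measurable_realfun.
From mathcomp Require Import zify ring lra.
Set Implicit Arguments.
Unset Strict Implicit.
Unset Printing Implicit Defensive.
Import Order.TTheory GRing.Theory Num.Theory.
Import numFieldNormedType.Exports.

(** Permutations and limit permutations are compared on the grid that cuts the
    unit square into K x K equal cells. A mass function p on the cells has a
    strict and a weak [pattern_mass] for tau: the probabilities that m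
    independent cells drawn from p are arranged like tau, without ties in a
    coordinate, or with ties allowed.

    If the positions and the values of a permutation pi are coloured
    monotonically by K colours each, the occurrences of tau in pi are squeezed
    between the two pattern masses of the cell frequencies of pi
    ([occurrences_ge], [occurrences_le]). In the same way t(tau, Z) / m! is
    squeezed between the pattern masses of the cell masses of Z
    ([limit_density_sandwich]). The strict and the weak mass differ only through
    samples with two points in one strip of the grid, so they are within a
    constant times 1 / K of each other ([pattern_mass_gap]), and both are
    Lipschitz in p for the l1 distance ([pattern_mass_lipschitz]). Hence
    t(tau, pi) and t(tau, Z) differ by at most a constant depending on tau times
    1 / K as soon as |pi| >= K and the cell frequencies of pi are within 1 / K
    of the cell masses of Z in l1 ([density_close]).

    Every limit permutation is a limit: multiply its cell masses by a large
    number, round them to integers, and take a permutation whose points have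
    these integers as cell counts ([permutation_with_counts]).

    Every convergent sequence has a limit: along an ultrafilter finer than the
    filter at infinity, the empirical distribution functions of the sigma_n
    converge pointwise to a copula F ([copula_ultralimit]). At each height y the
    function F(., y) is Lipschitz, so it has a Lebesgue density, which is almost
    everywhere its derivative; these derivatives lie in [0, 1] and increase with
    y. Z(x, y) is the supremum over the rational heights q < y of the densities
    at x, with the uniform cdf put in on a null set of bad x
    ([copula_limit_permutation]). The cell masses of Z are then rectangle
    differences of F, that is, the limits along the ultrafilter of the cell
    frequencies of sigma_n. So [density_close] makes t(tau, Z) the limit of
    t(tau, sigma_n) along the ultrafilter, and this is the limit of the sequence
    because the sequence converges.

    A limit permutation is measurable for the completed plane only. The integral
    of a nonnegative function is a supremum over the simple functions below it,
    hence monotone without any measurability ([le_lower_integral]); so it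
    suffices to squeeze the integrands between Borel functions with equal
    integrals, which exist because every section Z(., y) is Borel measurable off
    a null set ([limit_permutation_section]). *)

Local Open Scope ring_scope.

(** * Patterns of independent points in a grid *)

(** The points (a i, b i) are arranged like the points (i, s i): strictly for
    r = ltn, and for r = leq up to the ties that a coarse grid creates. *)
Definition has_pattern (r : rel nat) m (s : 'S_m) (a b : 'I_m -> nat) : bool :=
  [forall i : 'I_m, forall j : 'I_m, (i < j)%N ==> r (a i) (a j)] &&
  [forall i : 'I_m, forall j : 'I_m, (s i < s j)%N ==> r (b i) (b j)].

(** For a probability p on the cells: the probability that m independent cells
    with law p have the pattern. *)
Definition pattern_mass (R : realFieldType) (r : rel nat) m (s : 'S_m) K
    (p : 'I_K * 'I_K -> R) : R :=
  \sum_(w : {ffun 'I_m -> 'I_K * 'I_K} |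
      has_pattern r s (fun i => (w i).1) (fun i => (w i).2)) \prod_i p (w i).

Section pattern_mass.
Variable R : realFieldType.

Lemma has_patternP (r : rel nat) m (s : 'S_m) (a b : 'I_m -> nat) :
  reflect ((forall i j : 'I_m, (i < j)%N -> r (a i) (a j)) /\
           (forall i j : 'I_m, (s i < s j)%N -> r (b i) (b j)))
          (has_pattern r s a b).
Proof.
apply: (iffP andP) => -[P Q]; split.
- by move=> i j ij; have /forallP/(_ i)/forallP/(_ j)/implyP := P; exact.
- by move=> i j ij; have /forallP/(_ i)/forallP/(_ j)/implyP := Q; exact.
- by apply/forallP => i; apply/forallP => j; apply/implyP; exact: P.
- by apply/forallP => i; apply/forallP => j; apply/implyP; exact: Q.
Qed.

(** By independence the points i and j both have class a with probability at most
    the square of the mass of a. One factor is at most e, and the other factors add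
    up to at most one over all a. *)
Lemma coincidence_mass m (C : finType) k (p : C -> R) (f : C -> 'I_k) (e : R)
    (i j : 'I_m) :
  0 <= e -> (forall c, 0 <= p c) -> \sum_c p c <= 1 ->
  (forall a, \sum_(c | f c == a) p c <= e) -> i != j ->
  \sum_(w : {ffun 'I_m -> C} | f (w i) == f (w j)) \prod_l p (w l) <= e.
Proof.
move=> e0 p0 p1 pe ij.
(* q a is p, with the factors at i and j restricted to the class a. *)
pose q a (l : 'I_m) c : R := if (l == i) || (l == j) then (f c == a)%:R * p c else p c.
have -> : \sum_(w : {ffun 'I_m -> C} | f (w i) == f (w j)) \prod_l p (w l) =
    \sum_a \sum_(w : {ffun 'I_m -> C}) \prod_l q a l (w l).
  rewrite exchange_big big_mkcond /=; apply: eq_bigr => w _.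
  have E a : \prod_l q a l (w l) =
      (f (w i) == a)%:R * (f (w j) == a)%:R * \prod_l p (w l).
    rewrite (bigD1 i)//= (bigD1 j) 1?eq_sym//= /q !eqxx orbT/=.
    rewrite [in RHS](bigD1 i)//= [in RHS](bigD1 j) 1?eq_sym//=.
    rewrite (eq_bigr (fun l => p (w l))); first by ring.
    by move=> l /andP[/negbTE-> /negbTE->].
  rewrite (eq_bigr _ (fun a _ => E a)).
  rewrite -big_distrl/=; case: eqVneq => [fE|fN].
    rewrite (bigD1 (f (w j)))//= fE eqxx mulr1 [X in (_ + X) * _]big1 ?addr0 ?mul1r// => a.
    by rewrite eq_sym => /negbTE->; rewrite mul0r.
  rewrite big1 ?mul0r// => a _.
  have [fi|_] := eqVneq (f (w i)) a; last by rewrite mul0r.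
  have [fj|_] := eqVneq (f (w j)) a; last by rewrite mulr0.
  by rewrite fi fj eqxx in fN.
under eq_bigr do rewrite -bigA_distr_bigA/=.
have row0 a : 0 <= \sum_(c | f c == a) p c by exact: sumr_ge0.
have sum0 : 0 <= \sum_c p c by exact: sumr_ge0.
have prodE a : \prod_l \sum_c q a l c <=
    (\sum_(c | f c == a) p c) * (\sum_(c | f c == a) p c).
  rewrite (bigD1 i)//= (bigD1 j) 1?eq_sym//= /q !eqxx orbT/=.
  have -> : \sum_c (f c == a)%:R * p c = \sum_(c | f c == a) p c.
    by rewrite [RHS]big_mkcond; apply: eq_bigr => c _; case: eqP; rewrite ?mul1r ?mul0r.
  rewrite mulrA ler_piMr ?mulr_ge0// prodr_ile1// => l /andP[/negbTE-> /negbTE->]/=.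
  by rewrite sum0 p1.
apply: (@le_trans _ _ (\sum_a e * \sum_(c | f c == a) p c)).
  apply: ler_sum => a _; apply: le_trans (prodE a) _.
  by apply: ler_wpM2r.
rewrite -mulr_sumr ler_piMr// (le_trans _ p1)//.
by rewrite [leRHS](partition_big f xpredT).
Qed.

(** A sample that has the weak but not the strict pattern has two points i and j
    in one strip {c.1 = a} or {c.2 = b}. There are m ^ 2 pairs (i, j), and each
    of the two kinds of coincidence has mass at most e. *)
Lemma pattern_mass_gap m (s : 'S_m) K (p : 'I_K * 'I_K -> R) (e : R) :
  0 <= e -> (forall c, 0 <= p c) -> \sum_c p c <= 1 ->
  (forall a, \sum_(c | c.1 == a) p c <= e) ->
  (forall b, \sum_(c | c.2 == b) p c <= e) ->
  pattern_mass leq s p <= pattern_mass ltn s p + (2 * m * m)%:R * e.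
Proof.
move=> e0 p0 p1 pe1 pe2.
pose eqc (w : {ffun 'I_m -> 'I_K * 'I_K}) i j :=
  (((w i).1 == (w j).1)%:R + ((w i).2 == (w j).2)%:R : R).
have pw0 (w : {ffun 'I_m -> 'I_K * 'I_K}) : 0 <= \prod_i p (w i) by exact: prodr_ge0.
apply: (@le_trans _ _ (pattern_mass ltn s p +
   \sum_(i < m) \sum_(j < m | i != j)
     \sum_(w : {ffun 'I_m -> 'I_K * 'I_K}) eqc w i j * \prod_l p (w l))).
  under [X in _ <= _ + X]eq_bigr do rewrite exchange_big.
  rewrite exchange_big/= /pattern_mass [leLHS]big_mkcond/=.
  rewrite [X in _ <= X + _]big_mkcond/= -big_split/=; apply: ler_sum => w _.
  have eqc0 i j : 0 <= eqc w i j by rewrite addr_ge0.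
  have sum0 : 0 <= \sum_(i < m) \sum_(j < m | i != j) eqc w i j * \prod_l p (w l).
    by apply: sumr_ge0 => i _; apply: sumr_ge0 => j _; exact: mulr_ge0.
  case: ifPn => [wle|_]; last by case: ifPn => _; rewrite addr_ge0.
  case: ifPn => [wlt|/negP wnlt]; first by rewrite lerDl.
  rewrite add0r.
  have [i [j [ij ijw]]] : exists i j, i != j /\
      (((w i).1 == (w j).1) || ((w i).2 == (w j).2)).
    apply: contrapT => wN; apply: wnlt; move: wle => /has_patternP[wle1 wle2].
    apply/has_patternP; split => i j ij.
    - have iNj : i != j by apply: contraTneq ij => ->; rewrite ltnn.
      rewrite /= ltn_neqAle wle1// andbT; apply/negP => E.
      by apply: wN; exists i, j; rewrite iNj -val_eqE/= E.
    - have iNj : i != j by apply: contraTneq ij => ->; rewrite ltnn.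
      rewrite /= ltn_neqAle wle2// andbT; apply/negP => E.
      by apply: wN; exists i, j; rewrite iNj -[X in _ || X]val_eqE/= E orbT.
  pose F i j := eqc w i j * \prod_l p (w l).
  have F0 i' j' : 0 <= F i' j' by exact: mulr_ge0.
  apply: (@le_trans _ _ (F i j)).
    by rewrite ler_peMl// /eqc; case/orP: ijw => ->; rewrite ?lerDl ?lerDr.
  apply: (@le_trans _ _ (\sum_(j < m | i != j) F i j)).
    by rewrite (bigD1 j)//= lerDl sumr_ge0.
  rewrite [leRHS](bigD1 i)//= lerDl sumr_ge0// => i' _.
  by rewrite sumr_ge0// => j' _; exact: F0.
rewrite lerD2l.
apply: (@le_trans _ _ (\sum_(i < m) \sum_(j < m) 2 * e)); last first.
  rewrite !sumr_const !card_ord -mulrnA -(mulr_natl (2 * e)) -mulnA [in leRHS]natrM.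
  by rewrite mulrCA mulrA.
apply: ler_sum => i _; rewrite [leLHS]big_mkcond/=; apply: ler_sum => j _.
case: ifPn => [ij|]; last by rewrite mulr_ge0.
rewrite /eqc; under eq_bigr do rewrite mulrDl.
rewrite big_split/= (_ : 2 * e = e + e); last by ring.
apply: lerD.
- rewrite (eq_bigr (fun w : {ffun 'I_m -> 'I_K * 'I_K} =>
    if (w i).1 == (w j).1 then \prod_l p (w l) else 0)); last first.
    by move=> w _; case: eqP; rewrite ?mul1r ?mul0r.
  by rewrite -big_mkcond/=; exact: coincidence_mass.
- rewrite (eq_bigr (fun w : {ffun 'I_m -> 'I_K * 'I_K} =>
    if (w i).2 == (w j).2 then \prod_l p (w l) else 0)); last first.
    by move=> w _; case: eqP; rewrite ?mul1r ?mul0r.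
  by rewrite -big_mkcond/=; exact: coincidence_mass.
Qed.

(** Telescoping: the factors x i are replaced by y i one after the other. *)
Lemma prod_dist m (x y : 'I_m -> R) :
  (forall i, 0 <= x i) -> (forall i, 0 <= y i) ->
  `|\prod_i x i - \prod_i y i| <= \sum_(j < m) \prod_(i < m)
     (if (i < j)%N then y i else if i == j then `|x i - y i| else x i).
Proof.
elim: m x y => [|m IH] x y x0 y0; first by rewrite !big_ord0 subrr normr0.
rewrite big_ord_recl [X in `|_ - X|]big_ord_recl [leRHS]big_ord_recl.
set X := \prod_(i < m) _; set Y := \prod_(i < m) _.
have -> : x ord0 * X - y ord0 * Y = (x ord0 - y ord0) * X + y ord0 * (X - Y) by ring.
apply: le_trans (ler_normD _ _) _; apply: lerD.
  rewrite normrM big_ord_recl/= (ger0_norm (_ : 0 <= X)) ?prodr_ge0//.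
apply: (@le_trans _ _ (y ord0 * `|X - Y|)); first by rewrite normrM ger0_norm.
apply: (@le_trans _ _ (y ord0 * (\sum_(j < m) \prod_(i < m) (if (i < j)%N then y (lift ord0 i)
   else if i == j then `|x (lift ord0 i) - y (lift ord0 i)| else x (lift ord0 i))))).
  by apply: ler_wpM2l => //; exact: IH.
rewrite mulr_sumr; apply: ler_sum => j _; rewrite big_ord_recl/=.
by apply: ler_wpM2l => //; apply: ler_prod => i _.
Qed.

(** Each term of the telescoped difference sums one factor over |p - q|, and the
    other factors have total mass at most one; there are m terms. *)
Lemma pattern_mass_lipschitz (r : rel nat) m (s : 'S_m) K (p q : 'I_K * 'I_K -> R) :
  (forall c, 0 <= p c) -> \sum_c p c <= 1 ->
  (forall c, 0 <= q c) -> \sum_c q c <= 1 ->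
  `|pattern_mass r s p - pattern_mass r s q| <= m%:R * \sum_c `|p c - q c|.
Proof.
move=> p0 p1 q0 q1; rewrite /pattern_mass -sumrB.
apply: le_trans (ler_norm_sum _ _ _) _.
apply: (@le_trans _ _ (\sum_(w : {ffun 'I_m -> 'I_K * 'I_K})
    `|\prod_i p (w i) - \prod_i q (w i)|)).
  by rewrite big_mkcond/=; apply: ler_sum => w _; case: ifP.
pose g (j i : 'I_m) c := if (i < j)%N then q c else if i == j then `|p c - q c| else p c.
apply: (@le_trans _ _ (\sum_(w : {ffun 'I_m -> 'I_K * 'I_K}) \sum_j \prod_i g j i (w i))).
  by apply: ler_sum => w _; exact: prod_dist.
rewrite exchange_big/= -[X in X%:R * _](card_ord m) mulr_natl -sumr_const.
apply: ler_sum => j _; rewrite -bigA_distr_bigA/= (bigD1 j)//=.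
have -> : \sum_c g j j c = \sum_c `|p c - q c|.
  by apply: eq_bigr => c _; rewrite /g ltnn eqxx.
rewrite ler_piMr ?sumr_ge0// prodr_ile1// => i ij.
have [ltij|ltij] := boolP (i < j)%N.
  under eq_bigr do rewrite /g ltij.
  by rewrite q1 sumr_ge0.
under eq_bigr do rewrite /g (negbTE ltij) (negbTE ij).
by rewrite p1 sumr_ge0.
Qed.

End pattern_mass.

(** * Occurrences in a permutation with coloured positions and values *)

Section permutation_sandwich.
Variables (R : realFieldType) (tau pi : permutation) (K : nat).
Let m := plength tau.
Let N := plength pi.
Variables al be : 'I_N -> 'I_K.
Hypotheses (al_mono : {homo al : i j / (i <= j)%N})
           (be_mono : {homo be : i j / (i <= j)%N}).

Definition cell_count (c : 'I_K * 'I_K) : nat :=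
  #|[set i : 'I_N | (al i, be (pfun pi i)) == c]|.

Definition cell_freq (c : 'I_K * 'I_K) : R := (cell_count c)%:R / N%:R.

Let colour i := (al i, be (pfun pi i)).

(* A family of m points with cells w is a function whose colouring is w. *)
Let sum_prod_count (P : pred {ffun 'I_m -> 'I_K * 'I_K}) :
  (\sum_(w : {ffun 'I_m -> 'I_K * 'I_K} | P w) \prod_l cell_count (w l))%N =
  #|[set f : {ffun 'I_m -> 'I_N} | P [ffun l => colour (f l)]]|.
Proof.
rewrite -sum1_card (partition_big (fun f : {ffun 'I_m -> 'I_N} =>
   [ffun l => colour (f l)]) P)/=; last by move=> f; rewrite inE.
apply: eq_bigr => w Pw; rewrite sum1dep_card.
transitivity #|family (fun l => [pred i | colour i == w l])|.
  rewrite card_family foldrE big_map big_enum/=; apply: eq_bigr => l _.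
  by rewrite /cell_count cardsE.
apply: eq_card => f; rewrite !inE; apply/familyP/andP => [fw|[_ /eqP<-] l].
  have -> : [ffun l => colour (f l)] = w.
    by apply/ffunP => l; rewrite ffunE; exact/eqP/fw.
  by rewrite Pw eqxx.
by rewrite inE ffunE.
Qed.

Let ffun_tuple (f : {ffun 'I_m -> 'I_N}) : m.-tuple 'I_N := [tuple f i | i < m].

(* Functions replace tuples, to match the index set of [pattern_mass]. *)
Let card_occurrences : #|occurrences tau pi| =
  #|[set f : {ffun 'I_m -> 'I_N} | ffun_tuple f \in occurrences tau pi]|.
Proof.
have inj : injective ffun_tuple.
  move=> f g fg; apply/ffunP => i.
  by have := congr1 (fun t => tnth t i) fg; rewrite !tnth_mktuple.
rewrite -(card_imset _ inj); apply: eq_card => t; apply/idP/imsetP => [tO|[f]].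
  have tE : ffun_tuple [ffun i => tnth t i] = t.
    by apply: eq_from_tnth => i; rewrite tnth_mktuple ffunE.
  by exists [ffun i => tnth t i]; [rewrite finset.in_set tE|rewrite tE].
by rewrite finset.in_set => fO ->.
Qed.

Let sum_cell_count : (\sum_c cell_count c)%N = N.
Proof.
rewrite -[RHS]card_ord -sum1_card (partition_big colour xpredT)//=.
by apply: eq_bigr => c _; rewrite sum1dep_card.
Qed.

Lemma cell_freq_ge0 c : 0 <= cell_freq c.
Proof. by rewrite divr_ge0. Qed.

Lemma sum_cell_freq : \sum_c cell_freq c = 1.
Proof.
by rewrite /cell_freq -mulr_suml -natr_sum sum_cell_count divff// pnatr_eq0.
Qed.

Let pattern_massE r : pattern_mass r (pfun tau) cell_freq =
  (\sum_(w : {ffun 'I_m -> 'I_K * 'I_K} |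
      has_pattern r (pfun tau) (fun i => (w i).1) (fun i => (w i).2))
      \prod_l cell_count (w l))%:R / N%:R ^+ m.
Proof.
rewrite natr_sum mulr_suml; apply: eq_bigr => w _.
by rewrite natr_prod big_split/= prodr_const card_ord exprVn.
Qed.

(** Colours are monotone, so points with strictly ordered colours are strictly
    ordered: a sample with the strict pattern is an occurrence. The power of N
    stands in place of the binomial because samples may repeat points. *)
Lemma occurrences_ge :
  pattern_mass ltn (pfun tau) cell_freq <= #|occurrences tau pi|%:R / N%:R ^+ m.
Proof.
rewrite pattern_massE sum_prod_count ler_wpM2r ?invr_ge0 ?exprn_ge0// ler_nat.
rewrite card_occurrences; apply/subset_leq_card/fintype.subsetP => f.
rewrite !inE => /has_patternP[Pa Pb].
have aP (i j : 'I_m) : (i < j)%N -> (f i < f j)%N.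
  move=> /Pa; rewrite !ffunE/= !ltnNge; apply: contra; exact: al_mono.
have bP (i j : 'I_m) : (pfun tau i < pfun tau j)%N -> (pfun pi (f i) < pfun pi (f j))%N.
  move=> /Pb; rewrite !ffunE/= !ltnNge; apply: contra; exact: be_mono.
apply/andP; split.
  apply/forallP => i; apply/forallP => j; apply/implyP => ij.
  by rewrite !tnth_mktuple aP.
apply/forallP => i; apply/forallP => j; rewrite !tnth_mktuple; apply/eqP.
apply/idP/idP => [|/bP//].
have [//|ji|/val_inj/perm_inj->] := ltngtP (pfun tau i) (pfun tau j).
  by move=> /ltn_trans/(_ (bP _ _ ji)); rewrite ltnn.
by rewrite ltnn.
Qed.

(** Strictly ordered points have weakly ordered colours. *)
Lemma occurrences_le :
  #|occurrences tau pi|%:R / N%:R ^+ m <= pattern_mass leq (pfun tau) cell_freq.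
Proof.
rewrite pattern_massE sum_prod_count ler_wpM2r ?invr_ge0 ?exprn_ge0// ler_nat.
rewrite card_occurrences; apply/subset_leq_card/fintype.subsetP => f.
rewrite !inE => /andP[/forallP Pa /forallP Pb].
apply/has_patternP; split => i j ij; rewrite !ffunE/=.
  apply/al_mono/ltnW.
  by have /forallP/(_ j)/implyP/(_ ij) := Pa i; rewrite !tnth_mktuple.
apply/be_mono/ltnW.
by have /forallP/(_ j)/eqP := Pb i; rewrite !tnth_mktuple ij.
Qed.

End permutation_sandwich.

Section density.
Variable R : realType.

Lemma occurrences_le_bin (tau pi : permutation) :
  (#|occurrences tau pi| <= 'C(plength pi, plength tau))%N.
Proof.
rewrite -card_ltn_sorted_tuples; apply/subset_leq_card/fintype.subsetP => t.
rewrite !inE => /andP[/forallP Pa _].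
rewrite /= sorted_pairwise; last exact: ltn_trans.
apply/(pairwiseP 0%N) => i j; rewrite !inE !size_map !size_tuple => im jm ij.
have E l (lm : (l < plength tau)%N) :
    nth 0%N [seq val i | i <- t] l = tnth t (Ordinal lm).
  rewrite (nth_map (tnth t (Ordinal lm))) ?size_tuple//.
  by congr (nat_of_ord _); rewrite [RHS](tnth_nth (tnth t (Ordinal lm))).
rewrite (E _ im) (E _ jm).
by have /forallP/(_ (Ordinal jm))/implyP := Pa (Ordinal im); exact.
Qed.

Lemma ffact_le_expn n m : (n ^_ m <= n ^ m)%N.
Proof. by elim: m => // m IH; rewrite ffactnSr expnSr leq_mul// leq_subr. Qed.

(** Bernoulli's inequality for the probability that m draws out of N with
    repetition are distinct. *)
Lemma ffact_expn_ratio m N : (m <= N)%N -> (0 < N)%N ->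
  1 - (m * m)%:R / N%:R <= (N ^_ m)%:R / N%:R ^+ m :> R.
Proof.
move=> mN N0; have N0' : 0 < N%:R :> R by rewrite ltr0n.
elim: m mN => [|m IH] mN; first by rewrite mul0n mul0r subr0 ffactn0 expr0 divr1.
have le1 : (N ^_ m)%:R / N%:R ^+ m <= 1 :> R.
  by rewrite ler_pdivrMr ?exprn_gt0// mul1r -natrX ler_nat ffact_le_expn.
have {}IH := IH (ltnW mN).
rewrite ffactnSr exprSr [in leRHS]natrM natrB ?(ltnW mN)// [in leRHS]invfM.
set x := (N ^_ m)%:R / _ in le1 IH *.
have -> : (N ^_ m)%:R * (N%:R - m%:R) * (N%:R ^- m / N%:R) = x - x * m%:R / N%:R :> R.
  by rewrite /x; field; rewrite gt_eqF// expf_neq0// gt_eqF.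
have : x * m%:R / N%:R <= m%:R / N%:R.
  by rewrite ler_wpM2r ?invr_ge0 ?ler0n// ler_piMl.
have -> : (m.+1 * m.+1)%:R / N%:R = (m * m)%:R / N%:R + m%:R / N%:R + m.+1%:R / N%:R :> R.
  by rewrite -!mulrDl -!natrD; congr (_%:R / _); lia.
have : 0 <= m.+1%:R / N%:R :> R by rewrite divr_ge0.
by move: IH; lra.
Qed.

(** Drawing m points without repetition, as in the density, or with repetition,
    changes the probability of an occurrence by the factor bounded in
    [ffact_expn_ratio]. *)
Lemma density_occurrences (tau pi : permutation) (m := plength tau) (N := plength pi) :
  (m <= N)%N ->
  `|density R tau pi - m`!%:R * (#|occurrences tau pi|%:R / N%:R ^+ m)| <=
    (m * m)%:R / N%:R.
Proof.
move=> mN; rewrite /density -/m -/N mN.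
have N0 : 0 < N%:R :> R by rewrite ltr0n.
have C0 : 0 < 'C(N, m)%:R :> R by rewrite ltr0n bin_gt0.
set o := #|_|%:R.
have -> : o / 'C(N, m)%:R - m`!%:R * (o / N%:R ^+ m) =
    o / 'C(N, m)%:R * (1 - (N ^_ m)%:R / N%:R ^+ m) :> R.
  rewrite -bin_ffact natrM; field.
  by rewrite !gt_eqF// exprn_gt0.
have le1 : (N ^_ m)%:R / N%:R ^+ m <= 1 :> R.
  by rewrite ler_pdivrMr ?exprn_gt0// mul1r -natrX ler_nat ffact_le_expn.
have d0 : 0 <= o / 'C(N, m)%:R by rewrite divr_ge0.
have d1 : o / 'C(N, m)%:R <= 1.
  by rewrite ler_pdivrMr// mul1r ler_nat occurrences_le_bin.
rewrite ger0_norm ?mulr_ge0 ?subr_ge0//.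
apply: le_trans (ler_piMl _ d1) _; first by rewrite subr_ge0.
by have := ffact_expn_ratio mN isT; lra.
Qed.
End density.

(** * Permutations with prescribed cell counts *)

Section permutation_of_counts.

(** Number the elements along a list of T sorted by f. *)
Lemma sorting_bijection (T : finType) N (f : T -> nat) : #|T| = N ->
  exists2 u : T -> 'I_N, bijective u & forall x y, (u x <= u y)%N -> (f x <= f y)%N.
Proof.
move=> cT; pose s := sort (fun x y => (f x <= f y)%N) (enum T).
have sE x : x \in s by rewrite mem_sort mem_enum.
have szs : size s = N by rewrite size_sort -cardE.
have ixN x : (index x s < N)%N by rewrite -szs index_mem.
have u_inj : injective (fun x => Ordinal (ixN x)).
  move=> x y /(congr1 val)/= /(congr1 (nth x s)).
  by rewrite !nth_index.
exists (fun x => Ordinal (ixN x)).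
  by apply: inj_card_bij => //; rewrite card_ord cT.
move=> x y /= xy.
have st : sorted (fun x y => (f x <= f y)%N) s.
  by apply: sort_sorted => a b; exact: leq_total.
have := sorted_leq_nth (leT := fun x y => (f x <= f y)%N) _ _ x st
  (index x s) (index y s).
rewrite !inE !index_mem !sE !nth_index//; apply=> // a b c.
exact: leq_trans.
Qed.

(** Put c u points in each cell u. Number all points once by increasing first
    coordinate and once by increasing second coordinate; pi sends the first
    number of a point to its second number. *)
Lemma permutation_with_counts K (c : 'I_K * 'I_K -> nat) : (0 < \sum_u c u)%N ->
  exists pi : permutation, plength pi = (\sum_u c u)%N /\
    exists al be : 'I_(plength pi) -> 'I_K,
      [/\ {homo al : i j / (i <= j)%N}, {homo be : i j / (i <= j)%N} &
          forall u, cell_count al be u = c u].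
Proof.
move=> c0; pose T := {u : 'I_K * 'I_K & 'I_(c u)}.
have cT : #|{: T}| = (\sum_u c u).-1.+1.
  rewrite prednK// card_tagged sumnE big_map big_enum/=.
  by apply: eq_bigr => u _; rewrite card_ord.
have [u [u' uK u'K] umono] := sorting_bijection (fun x => val (tag x).1) cT.
have [v [v' vK v'K] vmono] := sorting_bijection (fun x => val (tag x).2) cT.
have s_inj : injective (fun i => v (u' i)).
  exact: inj_comp (can_inj vK) (can_inj u'K).
exists (Tagged (fun n => 'S_n.+1) (perm s_inj)).
split; first by rewrite /plength/= prednK.
exists (fun i => (tag (u' i)).1), (fun i => (tag (v' i)).2); split.
- by move=> i j ij; apply: umono; rewrite !u'K.
- by move=> i j ij; apply: vmono; rewrite !v'K.
move=> w; rewrite /cell_count.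
have -> : #|[set i | ((tag (u' i)).1, (tag (v' (perm s_inj i))).2) == w]| =
    #|[set x : T | tag x == w]|.
  rewrite -(card_imset _ (can_inj u'K)); apply: eq_card => x.
  rewrite !inE; apply/imsetP/idP => [[i]|/eqP xw].
    by rewrite !inE permE vK -surjective_pairing => /eqP + ->; move=> ->.
  exists (u x); rewrite ?uK// !inE permE vK uK -surjective_pairing; exact/eqP.
have T_inj : injective (fun j : 'I_(c w) => Tagged (fun u => 'I_(c u)) j).
  by move=> j k /eqP; rewrite eq_Tagged => /eqP.
rewrite -[RHS]card_ord -(card_imset _ T_inj); apply: eq_card => -[w' j].
rewrite !inE/=; apply/eqP/imsetP => [E|[k _ /(congr1 tag)]//].
by subst w'; exists j.
Qed.
End permutation_of_counts.

Local Open Scope classical_set_scope.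

(** * Integrals of nonnegative functions *)

Section integrals.
Local Open Scope ereal_scope.

Import HBNNSimple.

(** The simple functions below f are below g, whatever the measurability of f and
    g. This is how iterated and completed integrals are bounded by Borel ones. *)
Lemma le_lower_integral d (T : measurableType d) (R : realType)
    (mu : {measure set T -> \bar R}) (D : set T) (f g : T -> \bar R) :
  (forall x, D x -> 0 <= f x) -> (forall x, D x -> f x <= g x) ->
  \int[mu]_(x in D) f x <= \int[mu]_(x in D) g x.
Proof.
move=> f0 fg; have g0 x : D x -> 0 <= g x.
  by move=> Dx; exact: le_trans (f0 _ Dx) (fg _ Dx).
rewrite !ge0_integralE//; apply: ge_ereal_sup.
move=> _ [h/= hf <-]; apply: ereal_sup_ubound; exists h => //= x.
apply: le_trans (hf x) _; rewrite /patch; case: ifPn => //.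
by rewrite inE => /fg.
Qed.

(** Tonelli's theorem, one coordinate after the other. *)
Lemma prod_measure_integral_prod d (T : measurableType d) (R : realType) n
    (mu : 'I_n -> {sigma_finite_measure set T -> \bar R})
    (f : 'I_n -> T -> R) (c : 'I_n -> R) :
  (forall i, measurable_fun setT (f i)) -> (forall i x, (0 <= f i x)%R) ->
  (forall i, \int[mu i]_x (f i x)%:E = (c i)%:E) ->
  \int[prod_measure mu]_t (\prod_(i < n) f i (tnth t i))%R%:E =
    (\prod_(i < n) c i)%R%:E.
Proof.
elim: n mu f c => [|n IH] mu f c mf f0 fc.
  rewrite /= big_ord0.
  under eq_integral do rewrite big_ord0.
  by rewrite integral_cst//= diracT mule1.
have mtnth (i : 'I_n) : measurable_fun setT (fun t : n.-tuple T => tnth t i).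
  exact: measurable_tnth.
have mprod n' (F : 'I_n' -> T -> R) : (forall i, measurable_fun setT (F i)) ->
    measurable_fun setT (fun t : n'.-tuple T => \prod_(i < n') F i (tnth t i))%R.
  move=> mF; apply: measurable_prod => i _.
  by apply: measurableT_comp => //; exact: measurable_tnth.
pose tcons (p : T * n.-tuple T) : n.+1.-tuple T := [tuple of p.1 :: p.2].
have mtcons : measurable_fun setT tcons by exact: measurable_cons.
pose nu := prod_measure (fun i => mu (lift ord0 i)).
transitivity (\int[pushforward (mu ord0 \x nu) tcons]_t
   (\prod_(i < n.+1) f i (tnth t i))%R%:E).
  exact: eq_measure_integral.
rewrite ge0_integral_pushforward//; last 2 first.
- by apply/measurable_EFinP; exact: mprod.
- by move=> t _; rewrite lee_fin prodr_ge0.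
rewrite preimage_setT.
have E p : ((fun t => (\prod_(i < n.+1) f i (tnth t i))%R%:E) \o tcons) p =
    (f ord0 p.1 * \prod_(i < n) f (lift ord0 i) (tnth p.2 i))%R%:E.
  rewrite /= big_ord_recl tnth0; congr (_ * _)%R%:E.
  apply: eq_bigr => i _; congr (f _ _).
  by rewrite !(tnth_nth point).
under eq_integral do rewrite E.
rewrite fubini_tonelli1//=; last 2 first.
- apply/measurable_EFinP; apply: measurable_funM.
    by apply: measurableT_comp => //; exact: measurable_fst.
  have mf' i : measurable_fun setT (f (lift ord0 i)) by [].
  exact: (measurableT_comp (mprod n (fun i => f (lift ord0 i)) mf') measurable_snd).
- by move=> p; rewrite lee_fin mulr_ge0// prodr_ge0.
rewrite /fubini_F/=.
under eq_integral => x _.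
  under eq_integral do rewrite EFinM.
  rewrite ge0_integralZl//=; last 3 first.
  - by apply/measurable_EFinP; exact: (mprod n (fun i => f (lift ord0 i))).
  - by move=> t _; rewrite lee_fin prodr_ge0.
  - by rewrite lee_fin.
  rewrite (IH _ (fun i => f (lift ord0 i)) (fun i => c (lift ord0 i)))//.
  over.
rewrite ge0_integralZr//; last 3 first.
- exact/measurable_EFinP.
- by move=> x _; rewrite lee_fin.
- rewrite lee_fin prodr_ge0// => i _.
  by rewrite -lee_fin -fc integral_ge0// => x _; rewrite lee_fin.
by rewrite fc -EFinM [in RHS]big_ord_recl.
Qed.

End integrals.

Lemma exists_natSinv_lt (R : realType) (e : R) : 0 < e ->
  exists n, n.+1%:R^-1 < e.
Proof.
move=> e0; have [N _ /(_ N (leqnn N))] := near_infty_natSinv_lt (PosNum e0).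
by exists N.
Qed.

Section completion.
Local Open Scope ereal_scope.

(** Meant for phi the identity from a completed measure space to the Borel space
    that it completes. *)
Lemma ge0_integral_transfer d1 d2 (C : measurableType d1) (T : measurableType d2)
    (R : realType) (phi : C -> T) (nu : {measure set C -> \bar R})
    (mu : {measure set T -> \bar R}) (f : T -> \bar R) :
  measurable_fun setT phi ->
  (forall A, measurable A -> nu (phi @^-1` A) = mu A) ->
  measurable_fun setT f -> (forall x, 0 <= f x) ->
  \int[nu]_x f (phi x) = \int[mu]_x f x.
Proof.
move=> mphi numu mf f0.
rewrite -(@ge0_integral_pushforward _ _ _ _ _ _ mphi nu setT f) => //.
by apply: eq_measure_integral => A mA _; exact: numu.
Qed.

Lemma ge0_integral_lebesgue_tuple (R : realType) m
    (f : m.-tuple (measurableTypeR R) -> \bar R) :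
  measurable_fun setT f -> (forall x, 0 <= f x) ->
  \int[lebesgue_tuple R m]_x f x = \int[borel_lebesgue_tuple R m]_x f x.
Proof.
move=> mf f0.
have mid : measurable_fun [set: lebesgue_space R m]
    (fun x : lebesgue_space R m => x : m.-tuple (measurableTypeR R)).
  by move=> _ A mA; rewrite setTI; exact: caratheodory_measurable_mu_ext.
have mE (A : set (m.-tuple (measurableTypeR R))) : measurable A ->
    lebesgue_tuple R m ((fun x : lebesgue_space R m => x) @^-1` A) =
    borel_lebesgue_tuple R m A.
  exact: measurable_mu_extE.
exact: (ge0_integral_transfer mid mE mf f0).
Qed.

Lemma ge0_integral_completed_lebesgue (R : realType) (f : measurableTypeR R -> \bar R) :
  measurable_fun setT f -> (forall x, 0 <= f x) ->
  \int[@completed_lebesgue_measure R]_x f x = \int[@lebesgue_measure R]_x f x.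
Proof.
move=> mf f0.
pose C := caratheodory_type (@wlength R idfun)^*%mu.
have mid : measurable_fun [set: C] (fun x : C => x : measurableTypeR R).
  by move=> _ A mA; rewrite setTI; exact: sub_caratheodory.
have mE (A : set (measurableTypeR R)) : measurable A ->
  @completed_lebesgue_measure R ((fun x : C => x) @^-1` A) = lebesgue_measure A by [].
exact: (ge0_integral_transfer mid mE mf f0).
Qed.

End completion.

(** * The cells of a regular subdivision of the unit interval *)

Section cells.
Variable R : realType.

(** The last cell contains its right end 1, so that the k.+1 cells partition
    the closed unit interval. *)
Definition cell k (a : nat) : set R :=
  [set` Interval (BLeft (a%:R / k.+1%:R)) (BSide (a < k)%N (a.+1%:R / k.+1%:R))].

Lemma cellP k a y : (a <= k)%N -> cell k a y <->
  a%:R / k.+1%:R <= y /\ (if (a < k)%N then y < a.+1%:R / k.+1%:R else y <= 1).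
Proof.
move=> ak; rewrite /cell/= itv_boundlr/= bnd_simp.
have [ltak|leka] := ltnP a k; first by rewrite bnd_simp; split=> /andP.
have -> : a = k by apply/eqP; rewrite eqn_leq ak leka.
by rewrite divff ?gt_eqF// bnd_simp; split => /andP.
Qed.

Lemma measurable_cell k a : measurable (cell k a : set (measurableTypeR R)).
Proof. exact: measurable_itv. Qed.

Lemma cell_sub01 k a y : (a <= k)%N -> cell k a y -> 0 <= y <= 1.
Proof.
move=> ak /(cellP _ ak)[ay ya]; rewrite (le_trans _ ay) ?divr_ge0//=.
move: ya; case: ifPn => // ak' /ltW/le_trans; apply.
by rewrite ler_pdivrMr// mul1r ler_nat ltnW.
Qed.

Lemma cell_mono k a b x y : (a <= k)%N -> (b <= k)%N ->
  cell k a x -> cell k b y -> x <= y -> (a <= b)%N.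
Proof.
move=> ak bk /(cellP _ ak)[ax _] /(cellP _ bk)[_ yb] xy.
have [//|ba] := leqP a b; move: yb; rewrite (leq_trans ba ak) => yb.
have := lt_le_trans (le_lt_trans (le_trans ax xy) yb).
move=> /(_ _ (lexx _)); rewrite ltr_pM2r ?invr_gt0// ltr_nat ltnS.
by rewrite leqNgt ba.
Qed.

Lemma cell_cover k y : 0 <= y <= 1 -> exists a : 'I_k.+1, cell k a y.
Proof.
move=> /andP[y0 y1].
pose P (a : nat) := (a <= k)%N && (a%:R / k.+1%:R <= y).
have P0 : exists a, P a by exists 0%N; rewrite /P mul0r y0.
have Pk a : P a -> (a <= k)%N by case/andP.
case: (ex_maxnP P0 Pk) => a /andP[ak ay] amax.
have ak1 : (a < k.+1)%N by [].
exists (Ordinal ak1); apply/cellP => //=; split=> //; case: ifPn => // ltak.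
rewrite ltNge; apply/negP => ya; have /amax : P a.+1 by rewrite /P ltak ya.
by rewrite ltnn.
Qed.

Lemma lebesgue_cell k (a : 'I_k.+1) :
  lebesgue_measure (cell k a : set (measurableTypeR R)) = (k.+1%:R^-1 : R)%:E.
Proof.
rewrite /cell lebesgue_measure_itv/= lte_fin ltr_pM2r ?invr_gt0// ltr_nat ltnSn.
by rewrite -EFinB -mulrBl -natrB// subSnn mul1r.
Qed.

(** Only the last cell [a, 1] differs from the defining property of the measure:
    its mass is the total mass 1 minus the mass F a of [0, a[. *)
Lemma cdf_measure_cell (F : R -> R) k (b : 'I_k.+1) : Defs.cdf F -> F 1 = 1 ->
  cdf_measure F (cell k b) = (F (b.+1%:R / k.+1%:R) - F (b%:R / k.+1%:R))%:E.
Proof.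
move=> cF F1; have [mu1 mu_co] := cdf_measureP cF.
have b0 : 0 <= b%:R / k.+1%:R :> R by rewrite divr_ge0.
have b1 : b%:R / k.+1%:R < b.+1%:R / k.+1%:R :> R.
  by rewrite ltr_pM2r ?invr_gt0// ltr_nat.
have b2 : b.+1%:R / k.+1%:R <= 1 :> R.
  by rewrite ler_pdivrMr// mul1r ler_nat ltn_ord.
rewrite -(mu_co _ _ b0 b1 b2) /cell.
have [//|kb] := ltnP b k.
have bk : b = k :> nat by apply/eqP; rewrite eqn_leq kb -ltnS ltn_ord.
rewrite mu_co// bk divff ?gt_eqF// F1; rewrite bk in b0 b1.
set a := k%:R / _ in b0 b1 *.
(* For a = 0 the interval [0, a[ is empty, and the cell is all of [0, 1]. *)
have [a0|aN0] := eqVneq a 0; first by rewrite a0 mu1 (cdf0 cF) subr0.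
have {}b0 : 0 < a by rewrite lt_neqAle eq_sym aN0.
rewrite divff ?gt_eqF// in b1.
have E : `[0, 1]%classic = `[0, a[ `|` `[a, 1] :> set R.
  by rewrite -itv_bndbnd_setU// bnd_simp ltW.
have := mu1; rewrite E measureU//=; last first.
  apply/seteqP; split => // y /= []; rewrite !in_itv/=.
  by move=> /andP[_ ya] /andP[]; rewrite leNgt ya.
rewrite mu_co// ?ltW// (cdf0 cF) subr0.
have fnum : cdf_measure F `[a, 1] \is a fin_num by exact: fin_num_measure.
rewrite -(fineK fnum) -EFinD => -[E1].
by congr EFin; apply/eqP; rewrite eq_sym subr_eq addrC E1.
Qed.

End cells.

(** * The density in a limit permutation lies between two pattern masses *)

Lemma integral_sum_prod d (T : measurableType d) (R : realType) n (W : finType)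
    (S : pred W) (mu : 'I_n -> {sigma_finite_measure set T -> \bar R})
    (f : W -> 'I_n -> T -> R) (c : W -> 'I_n -> R) :
  (forall w i, measurable_fun setT (f w i)) -> (forall w i x, 0 <= f w i x) ->
  (forall w i, (\int[mu i]_x (f w i x)%:E = (c w i)%:E)%E) ->
  (\int[prod_measure mu]_t (\sum_(w | S w) \prod_(i < n) f w i (tnth t i))%:E =
    (\sum_(w | S w) \prod_(i < n) c w i)%:E)%E.
Proof.
move=> mf f0 fc.
under eq_integral do rewrite -big_filter -sumEFin.
rewrite ge0_integral_sum//; last 2 first.
- move=> w; apply/measurable_EFinP; apply: measurable_prod => i _.
  by apply: measurableT_comp => //; exact: measurable_tnth.
- by move=> w t _; rewrite lee_fin prodr_ge0.
rewrite -[in RHS]big_filter -sumEFin; apply: eq_bigr => w _.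
exact: prod_measure_integral_prod.
Qed.

Section limit_density_in_cells.
Variable R : realType.
Implicit Type Z : R -> R -> R.

Lemma measurable_increasing_tuples m :
  measurable (@increasing_tuples R m : set (m.-tuple (measurableTypeR R))).
Proof.
have mtnth i := @measurable_tnth _ (measurableTypeR R) m i.
rewrite (_ : @increasing_tuples R m = \bigcap_(i in [set: 'I_m])
   ((fun t => tnth t i) @^-1` `[0, 1]%classic `&`
    \bigcap_(j in [set j : 'I_m | (i < j)%N]) [set t | tnth t i < tnth t j])).
  apply: fin_bigcap_measurable => // i _; apply: measurableI.
    by rewrite -[X in measurable X]setTI; exact: mtnth.
  apply: fin_bigcap_measurable => // j _.
  have := measurable_fun_ltr (mtnth i) (mtnth j) measurableT (_ : measurable [set true]).
  by rewrite setTI; exact.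
apply/seteqP; split => t.
  by move=> [t01 tlt] i _; split=> [|j ij]; [rewrite /= in_itv/=; exact: t01|exact: tlt].
move=> tP; split => [i|i j ij].
  by have [+ _] := tP i I; rewrite /= in_itv.
by have [_ /(_ j ij)] := tP i I.
Qed.

(** The mass that the cdf Z x gives to the second coordinate of the cell c, for x
    in the first one. *)
Definition cell_slice Z k (c : 'I_k.+1 * 'I_k.+1) (x : R) : R :=
  \1_(cell k c.1 : set R) x *
    (Z x (c.2.+1%:R / k.+1%:R) - Z x (c.2%:R / k.+1%:R)).

(** p c is the mass of the cell c, the integral of its slice over x. The slice is
    measurable for the completed Lebesgue measure only, so its integral is
    expressed by two Borel functions around the slice. *)
Definition cell_masses Z k (p : 'I_k.+1 * 'I_k.+1 -> R) : Prop :=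
  forall c, exists lo hi : measurableTypeR R -> measurableTypeR R,
    [/\ measurable_fun setT lo, measurable_fun setT hi,
        forall x, 0 <= lo x /\ lo x <= cell_slice Z c x <= hi x,
        (\int[lebesgue_measure]_x (lo x)%:E = (p c)%:E)%E &
        (\int[lebesgue_measure]_x (hi x)%:E = (p c)%:E)%E].

Section fixed_permutation.
Variables (tau : permutation) (Z : R -> R -> R) (k : nat).
Let m := plength tau.
Let t' := ((pfun tau)^-1)%g.
Hypotheses (Zcdf : forall x, 0 <= x <= 1 -> Defs.cdf (Z x))
  (Z1 : forall x, 0 <= x <= 1 -> Z x 1 = 1).

(* The indicator of: for all i, the point (x_i, y_(tau i)) is in the cell w i.
   The factors are indexed by j = tau i because the measure that integrates y_j
   is that of the cdf at x_(tau^-1 j). *)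
Let matches (w : {ffun 'I_m -> 'I_k.+1 * 'I_k.+1}) (x y : m.-tuple R) : R :=
  \prod_(j < m) (\1_(cell k (w (t' j)).1 : set R) (tnth x (t' j)) *
                 \1_(cell k (w (t' j)).2 : set R) (tnth y j)).

Let pat r (w : {ffun 'I_m -> 'I_k.+1 * 'I_k.+1}) :=
  has_pattern r (pfun tau) (fun i => (w i).1) (fun i => (w i).2).

Let ord_le (i : 'I_k.+1) : (i <= k)%N. Proof. by rewrite -ltnS ltn_ord. Qed.

Let matchesP w (x y : m.-tuple R) : matches w x y =
  `[< forall i, cell k (w i).1 (tnth x i) /\
                cell k (w i).2 (tnth y (pfun tau i)) >]%:R.
Proof.
case: asboolP => [xy|Nxy].
  rewrite /matches big1// => j _; have [? yj] := xy (t' j).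
  by rewrite !indicE !mem_set ?mulr1//; rewrite permKV in yj.
have [i Ni] : exists i, ~ (cell k (w i).1 (tnth x i) /\
                cell k (w i).2 (tnth y (pfun tau i))).
  by apply: contrapT => H; apply: Nxy => i; apply: contrapT => Hi; apply: H; exists i.
rewrite /matches (bigD1 (pfun tau i))//= permK !indicE.
case: (boolP (_ \in cell _ _)) => [/set_mem xi|]; last by rewrite mul0r mul0r.
case: (boolP (_ \in cell _ _)) => [/set_mem yi|]; last by rewrite mulr0 mul0r.
by case: Ni.
Qed.

Let matches_uniq (w w' : {ffun 'I_m -> 'I_k.+1 * 'I_k.+1}) (x y : m.-tuple R) :
  (forall i, cell k (w i).1 (tnth x i) /\ cell k (w i).2 (tnth y (pfun tau i))) ->
  (forall i, cell k (w' i).1 (tnth x i) /\ cell k (w' i).2 (tnth y (pfun tau i))) ->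
  w = w'.
Proof.
move=> wP wP'; apply/ffunP => i; have [a b] := wP i; have [a' b'] := wP' i.
have eq_cell (u v : 'I_k.+1) (z : R) : cell k u z -> cell k v z -> u = v.
  move=> uz vz; apply/val_inj/eqP; rewrite eqn_leq.
  by rewrite !(cell_mono (ord_le _) (ord_le _) _ _ (lexx z)).
by rewrite (surjective_pairing (w i)) (surjective_pairing (w' i))
  (eq_cell _ _ _ a a') (eq_cell _ _ _ b b').
Qed.

Let incr (x y : m.-tuple R) : R := \1_(@increasing_tuples R m) x * \1_(@increasing_tuples R m) y.

(* At most one w matches x and y, and if it has the strict pattern then the
   points in its cells are strictly ordered. *)
Let lower_match x y : \sum_(w | pat ltn w) matches w x y <= incr x y.
Proof.
have [[w [wpat wxy]]|Nw] := pselect (exists w, pat ltn w /\ forall i,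
   cell k (w i).1 (tnth x i) /\ cell k (w i).2 (tnth y (pfun tau i))); last first.
  rewrite big1 ?mulr_ge0//= => w wpat; rewrite matchesP asboolF// => wxy.
  by apply: Nw; exists w.
have -> : incr x y = 1.
  have lt_cell (u v : 'I_k.+1) (z z' : R) : cell k u z -> cell k v z' ->
      (u < v)%N -> z < z'.
    move=> uz vz uv; rewrite ltNge; apply/negP => zz.
    by have := cell_mono (ord_le v) (ord_le u) vz uz zz; rewrite leqNgt uv.
  have [pa pb] := has_patternP _ _ _ _ wpat.
  rewrite /incr !indicE !mem_set ?mulr1//; split.
  - move=> i; have [_] := wxy (t' i); rewrite permKV; exact: cell_sub01.
  - move=> i j ij; have [_] := wxy (t' i); have [_] := wxy (t' j).
    rewrite !permKV => yj yi; apply: (lt_cell _ _ _ _ yi yj).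
    by apply: pb; rewrite !permKV.
  - by move=> i; have [+ _] := wxy i; exact: cell_sub01.
  - move=> i j ij; have [xi _] := wxy i; have [xj _] := wxy j.
    by apply: (lt_cell _ _ _ _ xi xj); exact: pa.
rewrite (bigD1 w)//= matchesP asboolT// big1 ?addr0// => w' /andP[_ /eqP w'w].
by rewrite matchesP asboolF// => w'xy; apply: w'w; exact: matches_uniq w'xy wxy.
Qed.

(* The cells of increasing points have the weak pattern. *)
Let upper_match x y : incr x y <= \sum_(w | pat leq w) matches w x y.
Proof.
have sum0 : 0 <= \sum_(w | pat leq w) matches w x y.
  by apply: sumr_ge0 => w _; rewrite matchesP.
rewrite /incr !indicE.
case: (boolP (x \in _)) => [/set_mem[x01 xlt]|]; last by rewrite mul0r.
case: (boolP (y \in _)) => [/set_mem[y01 ylt]|]; last by rewrite mulr0.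
have /choice[a aP] : forall i, exists a : 'I_k.+1, cell k a (tnth x i).
  by move=> i; exact: cell_cover.
have /choice[b bP] : forall i, exists b : 'I_k.+1, cell k b (tnth y (pfun tau i)).
  by move=> i; exact: cell_cover.
pose w := [ffun i => (a i, b i)].
have wpat : pat leq w.
  apply/has_patternP; split => i j ij; rewrite !ffunE/=.
    exact: (cell_mono (ord_le _) (ord_le _) (aP i) (aP j) (ltW (xlt _ _ ij))).
  exact: (cell_mono (ord_le _) (ord_le _) (bP i) (bP j) (ltW (ylt _ _ ij))).
rewrite (bigD1 w)//= matchesP asboolT; last by move=> i; rewrite /w ffunE; split; [exact: aP|exact: bP].
by rewrite mulr1 lerDl sumr_ge0// => w' _; rewrite matchesP.
Qed.

Let inner (x : m.-tuple R) : R :=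
  \int[prod_measure (fun i : 'I_m => cdf_measure (Z (tnth x (t' i))))]_
      (y in @increasing_tuples R m) 1.

Let int_matches r (x : m.-tuple R) : (forall i, 0 <= tnth x i <= 1) ->
  (\int[prod_measure (fun i : 'I_m => cdf_measure (Z (tnth x (t' i))))]_y
     (\sum_(w | pat r w) matches w x y)%:E =
   (\sum_(w | pat r w) \prod_i cell_slice Z (w i) (tnth x i))%:E)%E.
Proof.
move=> x01.
transitivity (\sum_(w | pat r w) \prod_(j < m) cell_slice Z (w (t' j)) (tnth x (t' j)))%:E.
  apply: (@integral_sum_prod _ (measurableTypeR R) R m {ffun 'I_m -> 'I_k.+1 * 'I_k.+1} (pat r)
    (fun j => cdf_measure (Z (tnth x (t' j))))
    (fun w j y => \1_(cell k (w (t' j)).1 : set R) (tnth x (t' j)) *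
                 \1_(cell k (w (t' j)).2 : set R) y)
    (fun w j => cell_slice Z (w (t' j)) (tnth x (t' j)))).
  - move=> w j; apply: measurable_funM; first exact: measurable_cst.
    by apply: measurable_indic; exact: measurable_cell.
  - by move=> w j y; rewrite mulr_ge0.
  - move=> w j; under eq_integral do rewrite EFinM.
    rewrite ge0_integralZl//; last by apply/measurable_EFinP; apply: measurable_indic; exact: measurable_cell.
    rewrite integral_indic ?setIT//; last exact: measurable_cell.
    have Ec := cdf_measure_cell (w (t' j)).2 (Zcdf (x01 (t' j))) (Z1 (x01 (t' j))).
    by apply: etrans (congr1 (mule _) Ec) _; rewrite -EFinM.
congr EFin; apply: eq_bigr => w _.
by rewrite [RHS](reindex_inj (@perm_inj _ t')).
Qed.

Let innerE x : (\int[prod_measure (fun i : 'I_m => cdf_measure (Z (tnth x (t' i))))]_y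
   (\1_(@increasing_tuples R m) y)%:E = (inner x)%:E)%E.
Proof.
set P := prod_measure _; have mI := @measurable_increasing_tuples m.
have PT : P setT = 1%E.
  have H := @prod_measureE _ _ R m (fun i : 'I_m => cdf_measure (Z (tnth x (t' i))))
    (fun=> setT) (fun=> measurableT).
  transitivity (P [set t | forall i : 'I_m, setT (tnth t i)]).
    by congr (P _); apply/seteqP; split.
  by rewrite [LHS]H big1// => i _; exact: probability_setT.
have Pfin : P (@increasing_tuples R m) \is a fin_num.
  rewrite ge0_fin_numE// (@le_lt_trans _ _ 1%E) ?ltry// -PT.
  by apply: le_measure; rewrite ?inE.
rewrite integral_indic// setIT /inner /Rintegral -/P.
have -> : (\int[P]_(y in @increasing_tuples R m) 1%:E)%E = P (@increasing_tuples R m).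
  by rewrite integral_cst// mul1e.
by rewrite fineK.
Qed.

Let inner_bounds (x : m.-tuple R) (x01 : forall i, 0 <= tnth x i <= 1) :
  \sum_(w | pat ltn w) \prod_i cell_slice Z (w i) (tnth x i) <=
    \1_(@increasing_tuples R m) x * inner x <=
  \sum_(w | pat leq w) \prod_i cell_slice Z (w i) (tnth x i).
Proof.
have E : (\int[prod_measure (fun i : 'I_m => cdf_measure (Z (tnth x (t' i))))]_y
    (incr x y)%:E = (\1_(@increasing_tuples R m) x * inner x)%:E)%E.
  under eq_integral do rewrite EFinM.
  rewrite ge0_integralZl//; last first.
    by apply/measurable_EFinP; apply: measurable_indic; exact: measurable_increasing_tuples.
  by rewrite innerE.
rewrite -!lee_fin -E -!int_matches//; apply/andP; split; apply: le_lower_integral.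
- by move=> y _; rewrite lee_fin sumr_ge0// => w _; rewrite matchesP.
- by move=> y _; rewrite lee_fin lower_match.
- by move=> y _; rewrite lee_fin mulr_ge0.
- by move=> y _; rewrite lee_fin upper_match.
Qed.

Lemma cell_slice_ge0 (c : 'I_k.+1 * 'I_k.+1) x : 0 <= cell_slice Z c x.
Proof.
rewrite /cell_slice indicE; case: (boolP (x \in _)) => [/set_mem xc|]; last by rewrite mul0r.
have x01 := cell_sub01 (ord_le c.1) xc.
rewrite mul1r subr_ge0; apply: (Defs.cdf_nondecreasing (Zcdf x01)).
- by rewrite divr_ge0.
- by rewrite ler_pM2r ?invr_gt0// ler_nat.
- by rewrite ler_pdivrMr// mul1r ler_nat ltn_ord.
Qed.

Lemma cell_slice_out (c : 'I_k.+1 * 'I_k.+1) x : ~ (0 <= x <= 1) -> cell_slice Z c x = 0.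
Proof.
move=> x01; rewrite /cell_slice indicE; case: (boolP (x \in _)); last by rewrite mul0r.
by move=> /set_mem/(cell_sub01 (ord_le c.1)).
Qed.

(* If some x_i is outside the unit interval, all three terms vanish. *)
Let outer_bounds (x : m.-tuple R) :
  \sum_(w | pat ltn w) \prod_i cell_slice Z (w i) (tnth x i) <=
    \1_(@increasing_tuples R m) x * inner x <=
  \sum_(w | pat leq w) \prod_i cell_slice Z (w i) (tnth x i).
Proof.
have [x01|/existsNP[i xi]] := pselect (forall i, 0 <= tnth x i <= 1).
  exact: inner_bounds.
rewrite indicE memNset ?mul0r; last by move=> -[/(_ i)].
rewrite sumr_ge0 ?andbT; last by move=> w _; apply: prodr_ge0 => j _; exact: cell_slice_ge0.
by rewrite big1// => w _; rewrite (bigD1 i)//= cell_slice_out// mul0r.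
Qed.

(** For fixed x the inner integral over increasing y lies between sums of
    products of slices, by integration of the cell indicators against the
    measures of the cdfs. The products of the Borel functions around the slices
    then integrate over x to products of the p c. *)
Lemma limit_density_sandwich (p : 'I_k.+1 * 'I_k.+1 -> R) : cell_masses Z p ->
  m`!%:R * pattern_mass ltn (pfun tau) p <= limit_density tau Z <=
  m`!%:R * pattern_mass leq (pfun tau) p.
Proof.
move=> /choice[lo /choice[hi lohi]].
have int_bound (f : 'I_k.+1 * 'I_k.+1 -> R -> R) r :
    (forall c, measurable_fun setT (f c : measurableTypeR R -> measurableTypeR R)) ->
    (forall c x, 0 <= f c x) ->
    (forall c, (\int[lebesgue_measure]_x (f c x)%:E = (p c)%:E)%E) ->
    (\int[lebesgue_tuple R m]_x (\sum_(w | pat r w) \prod_i f (w i) (tnth x i))%:E =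
    (pattern_mass r (pfun tau) p)%:E)%E.
  move=> mf f0 fp; rewrite ge0_integral_lebesgue_tuple; last 2 first.
  - apply/measurable_EFinP; under eq_fun do rewrite -big_filter.
    apply: measurable_sum => w; apply: measurable_prod => i _.
    exact: (measurableT_comp (mf (w i)) (@measurable_tnth _ (measurableTypeR R) m i)).
  - by move=> x; rewrite lee_fin sumr_ge0// => w _; rewrite prodr_ge0.
  exact: (@integral_sum_prod _ (measurableTypeR R) R m {ffun 'I_m -> 'I_k.+1 * 'I_k.+1}
    (pat r) (fun=> lebesgue_measure) (fun w i => f (w i)) (fun w i => p (w i))
    (fun w i => mf (w i)) (fun w i x => f0 (w i) x) (fun w i => fp (w i))).
have bound : ((pattern_mass ltn (pfun tau) p)%:E <=
    \int[lebesgue_tuple R m]_x (\1_(@increasing_tuples R m) x * inner x)%:E <=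
    (pattern_mass leq (pfun tau) p)%:E)%E.
  rewrite -(int_bound lo ltn); last 3 first.
  - by move=> c; have [] := lohi c.
  - by move=> c x; have [_ _ /(_ x)[]] := lohi c.
  - by move=> c; have [] := lohi c.
  rewrite -(int_bound hi leq); last 3 first.
  - by move=> c; have [] := lohi c.
  - move=> c x; have [_ _ /(_ x)[lo0 /andP[lo1 hi1]]] := lohi c.
    move=> _ _; exact: le_trans lo0 (le_trans lo1 hi1).
  - by move=> c; have [] := lohi c.
  apply/andP; split; apply: le_lower_integral => x _.
  - rewrite lee_fin sumr_ge0// => w _; apply: prodr_ge0 => i _.
    by have [_ _ /(_ (tnth x i))[]] := lohi (w i).
  - rewrite lee_fin; have /andP[ob _] := outer_bounds x; apply: le_trans ob.
    apply: ler_sum => w _; apply: ler_prod => i _.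
    by have [_ _ /(_ (tnth x i))[-> /andP[->]]] := lohi (w i).
  - rewrite lee_fin; have /andP[ob _] := outer_bounds x; apply: le_trans ob.
    by rewrite sumr_ge0// => w _; apply: prodr_ge0 => i _; exact: cell_slice_ge0.
  - rewrite lee_fin; have /andP[_ ob] := outer_bounds x; apply: le_trans ob _.
    apply: ler_sum => w _; apply: ler_prod => i _; rewrite cell_slice_ge0/=.
    by have [_ _ /(_ (tnth x i))[_ /andP[_]]] := lohi (w i).
have -> : limit_density tau Z = m`!%:R *
    fine (\int[lebesgue_tuple R m]_x (\1_(@increasing_tuples R m) x * inner x)%:E)%E.
  rewrite /limit_density; congr (_ * _); rewrite /Rintegral integral_mkcond.
  congr fine; apply: eq_integral => x _; rewrite /patch indicE.
  by case: ifP => _; rewrite ?mul1r ?mul0r.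
(* The bounds make the integral finite, so that [fine] keeps them. *)
move: bound; case: (\int[_]_x _)%E => [r| |]/=.
- by rewrite !lee_fin => /andP[? ?]; rewrite !ler_wpM2l.
- by rewrite andbF.
- by [].
Qed.

End fixed_permutation.
End limit_density_in_cells.

(** * Closeness of densities from closeness of cell masses *)

Section density_close.
Variable R : realType.

Lemma cell_masses_ge0 (Z : R -> R -> R) k (p : 'I_k.+1 * 'I_k.+1 -> R) c :
  cell_masses Z p -> 0 <= p c.
Proof.
move=> /(_ c)[lo [hi [_ _ lo0 lop _]]]; rewrite -lee_fin -lop.
by apply: integral_ge0 => x _; rewrite lee_fin; case: (lo0 x).
Qed.

(** With q the cell frequencies of pi: replacing the binomial by a power costs
    m ^ 2 e. The other costs are multiplied by m!: the gaps between strict and weak masses are at most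
    2 m ^ 2 (2 e) for p and for q, since every strip has p-mass 1 / k.+1 <= e
    and therefore q-mass at most 2 e; passing from q to p costs m e. *)
Lemma density_close (tau pi : permutation) (Z : R -> R -> R) k
    (p : 'I_k.+1 * 'I_k.+1 -> R) (al be : 'I_(plength pi) -> 'I_k.+1) (e : R)
    (m := plength tau) :
  (forall x, 0 <= x <= 1 -> Defs.cdf (Z x)) -> (forall x, 0 <= x <= 1 -> Z x 1 = 1) ->
  cell_masses Z p ->
  (forall a, \sum_(c | c.1 == a) p c = k.+1%:R^-1) ->
  (forall b, \sum_(c | c.2 == b) p c = k.+1%:R^-1) ->
  {homo al : i j / (i <= j)%N} -> {homo be : i j / (i <= j)%N} ->
  (m <= plength pi)%N -> (plength pi)%:R^-1 <= e -> k.+1%:R^-1 <= e ->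
  \sum_c `|cell_freq R al be c - p c| <= e ->
  `|density R tau pi - limit_density tau Z| <=
    ((m * m)%:R + m`!%:R * (m%:R + (4 * m * m)%:R)) * e.
Proof.
move=> Zcdf Z1 pZ rowp colp al_mono be_mono mN Ne Ke qpe.
set q := cell_freq R al be in qpe *.
have e0 : 0 <= e by apply: le_trans Ke; rewrite invr_ge0.
have p0 c : 0 <= p c by exact: cell_masses_ge0 pZ.
have q0 c : 0 <= q c by exact: cell_freq_ge0.
have q1 : \sum_c q c = 1 by exact: sum_cell_freq.
have p1 : \sum_c p c = 1.
  rewrite (partition_big (fun c => c.1) xpredT)//=.
  under eq_bigr do rewrite rowp.
  by rewrite sumr_const card_ord -[_ *+ _]mulr_natr mulVf// pnatr_eq0.
have e2 : 0 <= 2 * e by rewrite mulr_ge0.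
have marg P : \sum_(c | P c) q c <= \sum_(c | P c) p c + e.
  rewrite -lerBlDl -sumrB; apply: le_trans qpe.
  rewrite [leLHS]big_mkcond; apply: ler_sum => c _; case: ifP => // _.
  exact: ler_norm.
have Ke2 : k.+1%:R^-1 <= 2 * e by apply: le_trans Ke _; lra.
have Kee : k.+1%:R^-1 + e <= 2 * e by rewrite (_ : 2 * e = e + e) ?lerD2r//; ring.
have gapp : pattern_mass leq (pfun tau) p <=
    pattern_mass ltn (pfun tau) p + (2 * m * m)%:R * (2 * e).
  apply: pattern_mass_gap => //; first by rewrite p1.
  - by move=> a; rewrite rowp.
  - by move=> a; rewrite colp.
have gapq : pattern_mass leq (pfun tau) q <=
    pattern_mass ltn (pfun tau) q + (2 * m * m)%:R * (2 * e).
  apply: pattern_mass_gap => //; first by rewrite q1.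
  - by move=> a; apply: le_trans (marg _) _; rewrite rowp.
  - by move=> a; apply: le_trans (marg _) _; rewrite colp.
have lip : `|pattern_mass ltn (pfun tau) q - pattern_mass ltn (pfun tau) p| <= m%:R * e.
  apply: le_trans (pattern_mass_lipschitz _ _ q0 _ p0 _) _; rewrite ?q1 ?p1//.
  by rewrite ler_wpM2l.
have /andP[tl tu] := limit_density_sandwich tau Zcdf Z1 pZ.
have sl := occurrences_ge R tau al_mono be_mono.
have su := occurrences_le R tau al_mono be_mono.
have ds := density_occurrences R mN.
set s := _ / _ in sl su ds.
set Lp := pattern_mass ltn _ p in gapp lip tl *.
set Lq := pattern_mass ltn _ q in gapq lip sl *.
set Up := pattern_mass leq _ p in gapp tu *.
set Uq := pattern_mass leq _ q in gapq su *.
set M : R := m`!%:R in tl tu ds *.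
have M0 : 0 <= M by [].
have dse : `|density R tau pi - M * s| <= (m * m)%:R * e.
  by apply: le_trans ds _; rewrite ler_wpM2l.
have E4 : (2 * m * m)%:R * (2 * e) = (4 * m * m)%:R * e by rewrite -!mulnA !natrM; ring.
rewrite E4 in gapp gapq.
set A := (4 * m * m)%:R * e in gapp gapq E4.
have A0 : 0 <= A by rewrite mulr_ge0.
have d2 : `|M * s - limit_density tau Z| <= M * (m%:R * e + A).
  move: lip; rewrite !ler_norml => /andP[l1 l2].
  have h1 : M * s <= M * (Lq + A) by rewrite ler_wpM2l//; lra.
  have h2 : M * Lq <= M * s by rewrite ler_wpM2l.
  have h3 : M * Up <= M * (Lp + A) by rewrite ler_wpM2l//; lra.
  have h4 : M * Lq <= M * (Lp + m%:R * e) by rewrite ler_wpM2l//; lra.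
  have h5 : M * Lp <= M * (Lq + m%:R * e) by rewrite ler_wpM2l//; lra.
  rewrite !mulrDr in h1 h2 h3 h4 h5 *.
  by apply/andP; split; lra.
have -> : ((m * m)%:R + M * (m%:R + (4 * m * m)%:R)) * e =
    (m * m)%:R * e + M * (m%:R * e + A) by rewrite /A; ring.
apply: le_trans (lerD dse d2).
by apply: le_trans (ler_normD _ _); rewrite addrA subrK.
Qed.

End density_close.

(** * Borel versions of Lebesgue measurable functions *)

Section completed_functions.
Context d (T : measurableType d) (R : realType).
Variable mu : {measure set T -> \bar R}.
Local Open Scope ereal_scope.

(** Intersect countable covers of A by measurable sets whose total measures tend
    to the outer measure of A. *)
Lemma measurable_hull (A : set T) : (mu^*)%mu A < +oo ->
  exists2 H, measurable H & A `<=` H /\ mu H = (mu^*)%mu A.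
Proof.
move=> Aoo.
have Afin : (mu^*)%mu A \is a fin_num by rewrite ge0_fin_numE// mu_ext_ge0.
have cover n : exists U, [/\ measurable U, A `<=` U &
    mu U <= (mu^*)%mu A + (n.+1%:R^-1)%:E].
  have n0 : (0 < n.+1%:R^-1 :> R)%R by rewrite invr_gt0.
  have [_ [F [mF AF] <-] /ltW muF] := lb_ereal_inf_adherent n0 Afin.
  exists (\bigcup_k F k); split => //; first exact: bigcupT_measurable.
  apply: le_trans muF.
  rewrite -[mu _]measurable_mu_extE; last exact: bigcupT_measurable.
  apply: le_trans (outer_measure_sigma_subadditive (mu^*)%mu F) _.
  by apply: lee_nneseries => // k _; rewrite [leLHS]measurable_mu_extE.
have /choice[U UP] := cover.
exists (\bigcap_k U k); first by apply: bigcapT_measurable => k; have [] := UP k.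
split; first by apply: sub_bigcap => k _; have [] := UP k.
apply/eqP; rewrite eq_le; apply/andP; split; last first.
  rewrite -[leRHS]measurable_mu_extE; first last.
    by apply: bigcapT_measurable => k; have [] := UP k.
  by apply: le_mu_ext; apply: sub_bigcap => k _; have [] := UP k.
apply/lee_addgt0Pr => e e0.
have [n ne] := exists_natSinv_lt e0.
have [mU _ muU] := UP n.
apply: (@le_trans _ _ (mu (U n))).
  apply: le_measure; rewrite ?inE//.
    by apply: bigcapT_measurable => k; have [] := UP k.
  exact: bigcap_inf.
by apply: le_trans muU _; rewrite leeD2l// lee_fin ltW.
Qed.

(** With G a measurable hull of S minus A inside S, the set S minus G is a
    measurable subset of A; what it misses of A is the intersection of G and A,
    which is null because A splits G additively. *)
Lemma completed_set_core (S A : set T) : measurable S -> mu S < +oo ->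
  A `<=` S -> (mu^*)%mu.-cara.-measurable A ->
  exists B N, [/\ measurable B, measurable N, mu N = 0,
    B `<=` A & A `\` B `<=` N].
Proof.
move=> mS Soo AS mA.
have muS X : X `<=` S -> (mu^*)%mu X < +oo.
  move=> XS; apply: le_lt_trans Soo.
  by rewrite -[leRHS]measurable_mu_extE//; exact: le_mu_ext.
have [H mH [HA muH]] := measurable_hull (muS (S `\` A) (@subDsetl _ _ _)).
pose G := H `&` S; have mG : measurable G by exact: measurableI.
have GA : G `\` A = S `\` A.
  apply/seteqP; split => x [] => [[_ Sx] nA|Sx nA]; first by [].
  by split=> //; split => //; exact: HA.
have muG : mu G = (mu^*)%mu (S `\` A).
  apply/eqP; rewrite eq_le; apply/andP; split.
    by rewrite -muH; apply: le_measure; rewrite ?inE//; exact: subIsetl.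
  by rewrite -[leRHS]measurable_mu_extE// -GA; apply: le_mu_ext; exact: subDsetl.
have GA0 : (mu^*)%mu (G `&` A) = 0.
  have muG' : (mu^*)%mu G = (mu^*)%mu (S `\` A) by rewrite measurable_mu_extE.
  have : (mu^*)%mu G = (mu^*)%mu (G `&` A) + (mu^*)%mu (G `&` ~` A) := mA G.
  rewrite -setDE GA muG'.
  have fin : (mu^*)%mu (S `\` A) \is a fin_num.
    by rewrite ge0_fin_numE ?mu_ext_ge0// muS//; exact: subDsetl.
  move: fin; case: ((mu^*)%mu (S `\` A)) => // r _.
  by case: ((mu^*)%mu (G `&` A)) => [s| |]//= -[E]; congr EFin; lra.
have [N mN [GAN muN]] : exists2 N, measurable N & (G `&` A) `<=` N /\ mu N = 0.
  by rewrite -GA0; apply: measurable_hull; rewrite GA0.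
exists (S `\` G), N; split => //; first exact: measurableD.
- move=> x [Sx nG]; apply: contrapT => nA; apply: nG; split => //.
  exact: HA.
- move=> x [Ax nB]; apply: GAN; split => //; apply: contrapT => nG.
  by apply: nB; split => //; exact: AS.
Qed.

(** Each superlevel set at a rational height has a measurable core, and N
    collects what these countably many cores miss. *)
Lemma completed_measurable_fun (S : set T) (f : T -> R) :
  measurable S -> mu S < +oo ->
  measurable_fun (S : set (caratheodory_type (mu^*)%mu)) f ->
  exists N, [/\ measurable N, mu N = 0 & measurable_fun (S `\` N) f].
Proof.
move=> mS Soo mf.
pose A (q : rat) := S `&` [set x | (ratr q <= f x)%R].
have core q : exists BN, [/\ measurable BN.1, measurable BN.2, mu BN.2 = 0,
    BN.1 `<=` A q & A q `\` BN.1 `<=` BN.2].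
  have [|B [N ?]] := @completed_set_core S (A q) mS Soo (@subIsetl _ _ _).
    rewrite /A (_ : [set x | _] = f @^-1` `[ratr q, +oo[%classic).
      apply: mf => //.
      by apply: caratheodory_measurable_mu_ext.
    by apply/seteqP; split => x /=; rewrite in_itv/= andbT.
  by exists (B, N).
have /choice[BN BNP] := core.
pose N n := if unpickle n is Some q then (BN q).2 else set0.
have mN n : measurable (N n) by rewrite /N; case: unpickle => // q; have [] := BNP q.
exists (\bigcup_n N n); split; first exact: bigcupT_measurable.
  apply/eqP; rewrite -measure_le0 -[leLHS]measurable_mu_extE; last exact: bigcupT_measurable.
  apply: le_trans (outer_measure_sigma_subadditive (mu^*)%mu N) _.
  rewrite eseries0// => n _ _; rewrite [LHS]measurable_mu_extE// /N.
  by case: unpickle => [q|]; [have [] := BNP q|exact: measure0].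
move=> mD; apply: (measurability _ (RGenOInfty.measurableE R)) => // _ [_ [c ->] <-].
pose F n := if unpickle n is Some q then
  if (c < ratr q)%R then (BN q).1 else set0 else set0.
rewrite (_ : _ `&` _ = (\bigcup_n F n) `\` \bigcup_n N n).
  apply: measurableD; last exact: bigcupT_measurable.
  apply: bigcupT_measurable => n; rewrite /F; case: unpickle => // q.
  by case: ifP => // _; have [] := BNP q.
apply/seteqP; split => x.
  move=> [[Sx Nx]]; rewrite /= in_itv/= andbT => cf; split => //.
  have [q] := rat_in_itvoo cf; rewrite in_itv/= => /andP[cq qf].
  have E : @unpickle rat (pickle q) = Some q by exact: pickleK.
  exists (pickle q); first exact: I.
  rewrite /F E cq; have [_ _ _ _ sub] := BNP q; apply: contrapT => nB; apply: Nx.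
  exists (pickle q); first exact: I.
  by rewrite /N E; apply: sub; split => //; split => //=; exact: ltW.
move=> [[n _ Fx] Nx]; move: Fx; rewrite /F; case: unpickle => // q.
case: ifPn => // cq Bx; have [_ _ _ sub _] := BNP q; have [Sx qf] := sub _ Bx.
by split => //=; rewrite in_itv/= andbT (lt_le_trans cq).
Qed.

End completed_functions.

Section sections.
Variable R : realType.
Local Notation lambda := (@lebesgue_measure R).

Lemma null_sections (N : set (measurableTypeR R * measurableTypeR R)) :
  measurable N -> (lambda \x lambda)%E N = 0%E ->
  exists M : set (measurableTypeR R), [/\ measurable M, lambda M = 0%E &
    forall y, ~ M y -> lambda (ysection N y) = 0%E].
Proof.
move=> mN N0.
have mphi := measurable_fun_ysection lambda mN.
have int0 : (\int[lambda]_y lambda (ysection N y) = 0)%E.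
  rewrite -[RHS]N0; apply/esym.
  have : (lambda \x lambda)%E N = (lambda \x^ lambda)%E N.
    by apply: product_measure_unique => //= A B mA mB; rewrite product_measure2E.
  by move=> ->.
have int0' : (\int[lambda]_(y in setT) `|lambda (ysection N y)| = 0)%E.
  by rewrite -[RHS]int0; apply: eq_integral => y _; rewrite gee0_abs.
have /(ae_eq_integral_abs _ measurableT mphi)[M [mM M0 sub]] := int0'.
exists M; split => // y My; apply: contrapT => Ny; apply: My; apply: sub => /=.
by move=> /(_ I).
Qed.

(** Tonelli's theorem gives the claim at almost every height only. Left
    continuity of Z x extends it: every y > 0 is the limit of good heights from
    the left. *)
Lemma limit_permutation_section (Z : R -> R -> R) (y : R) :
  limit_permutation Z -> 0 <= y <= 1 ->
  exists N : set (measurableTypeR R), [/\ measurable N, lambda N = 0%E &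
    measurable_fun (`[0, 1]%classic `\` N : set (measurableTypeR R)) (Z ^~ y)].
Proof.
move=> Zlim /andP[]; rewrite le_eqVlt => /predU1P[<- _|y0 y1].
  exists set0; split => //; rewrite ?measure0// setD0.
  apply: (@eq_measurable_fun _ _ (measurableTypeR R) R _ (fun=> 0 : R)); last exact: measurable_cst.
  move=> x /set_mem; rewrite /= in_itv/= => x01.
  by rewrite (cdf0 (limit_permutation_cdf Zlim x01)).
pose S : set (measurableTypeR R * measurableTypeR R) := `[0, 1] `*` `[0, 1].
have mS : measurable S by exact: measurableX.
have Soo : ((lambda \x lambda) S < +oo)%E.
  have L : lambda `[0, 1]%classic = 1%E.
    by rewrite lebesgue_measure_itv/= lte_fin ltr01 oppr0 adde0.
  rewrite product_measure1E//.
  by apply: (@le_lt_trans _ _ (1 * 1)%E); [rewrite -L lexx|rewrite mule1 ltry].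
have SE : S = [set p | 0 <= p.1 <= 1 /\ 0 <= p.2 <= 1].
  by apply/seteqP; split => -[u v]; rewrite /S/= !in_itv/=.
have mZ : measurable_fun (S : set (lebesgue_plane R)) (fun p => Z p.1 p.2).
  by rewrite SE; exact: limit_permutation_measurable Zlim.
have [N [mN N0 mZN]] := completed_measurable_fun mS Soo mZ.
have [M [mM M0 MP]] := null_sections mN N0.
(* The bad heights M are null, so they cannot fill an interval ending at y. *)
have good n : exists z, [/\ ~ M z, 0 <= z <= 1, z < y & y - n.+1%:R^-1 < z].
  pose a := Num.max 0 (y - n.+1%:R^-1).
  have ay : a < y by rewrite gt_max y0 ltrBlDr ltrDl invr_gt0 ltr0n.
  apply: contrapT => /forallNP H.
  have sub : `]a, y[%classic `<=` M.
    move=> z /=; rewrite in_itv/= gt_max => /andP[/andP[z0 yz] zy].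
    apply: contrapT => Mz; apply: (H z); split => //.
    by rewrite ltW//= (le_trans (ltW zy)).
  have : (lambda `]a, y[%classic <= lambda M)%E by apply: le_measure; rewrite ?inE.
  rewrite M0 lebesgue_measure_itv/= lte_fin ay -EFinB lee_fin subr_le0.
  by rewrite leNgt ay.
have /choice[z zP] := good.
have zM n : ~ M (z n) by case: (zP n).
pose NN := \bigcup_n ysection N (z n).
have mNN : measurable (NN : set (measurableTypeR R)).
  by apply: bigcupT_measurable => n; exact: measurable_ysection.
exists NN; split => //.
  apply/negligibleP => //; apply: negligible_bigcup => n.
  by apply/negligibleP; [exact: measurable_ysection|exact: MP].
apply: (@measurable_fun_cvg _ _ _ _ (fun n x => Z x (z n))).
  move=> n; have [_ z01 _ _] := zP n.
  apply: (@measurable_funS _ _ _ _ (`[0, 1]%classic `\` ysection N (z n))).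
  - by apply: measurableD => //; exact: measurable_ysection.
  - by apply: setDS => x Nx; exists n.
  apply: (@measurable_comp _ _ _ _ _ _ (S `\` N) (fun p => Z p.1 p.2) _ (fun x => (x, z n))).
  - exact: measurableD.
  - move=> _ [x [x01 Nx] <-]; split; first by split => //=; rewrite in_itv.
    by move=> Nxz; apply: Nx; rewrite /ysection/=; exact/mem_set.
  - by [].
  - by apply: measurable_funTS; exact: measurable_pair2.
move=> x [/=]; rewrite in_itv/= => x01 _.
have cF := cdf_left_continuous (limit_permutation_cdf Zlim x01) (introT andP (conj y0 y1)).
move: cF => /cvg_at_leftP/(_ z); apply; split => [n|]; first by case: (zP n).
apply/cvgrPdist_lt => e e0; near=> n.
have [_ _ zy yz] := zP n; rewrite ger0_norm ?subr_ge0 ?ltW//.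
have : n.+1%:R^-1 < e by near: n; exact: (near_infty_natSinv_lt (PosNum e0)).
by move: yz; move: (n.+1%:R^-1) => i; lra.
Unshelve. all: by end_near. Qed.
End sections.

(** * Cell masses of a limit permutation *)

Section cell_masses_of_limit_permutation.
Variable R : realType.
Implicit Type Z : R -> R -> R.

Lemma lebesgue_measure01 : lebesgue_measure (`[0, 1]%classic : set R) = 1%E.
Proof. by rewrite lebesgue_measure_itv/= lte_fin ltr01 oppr0 adde0. Qed.

Lemma indic_cell k (a b : 'I_k.+1) (x : R) : cell k b x ->
  \1_(cell k a : set R) x = (a == b)%:R :> R.
Proof.
have ord_le (i : 'I_k.+1) : (i <= k)%N by rewrite -ltnS ltn_ord.
move=> xb; rewrite indicE; congr (_ : bool)%:R; apply/idP/idP => [/set_mem xa|/eqP->].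
  rewrite -val_eqE eqn_leq.
  by rewrite !(cell_mono (ord_le _) (ord_le _) _ _ (lexx x)).
exact/mem_set.
Qed.

Lemma integral_cell_masses Z k (p : 'I_k.+1 * 'I_k.+1 -> R)
    (S : pred ('I_k.+1 * 'I_k.+1)) (h : R -> R) :
  cell_masses Z p -> (forall x, h x = \sum_(c | S c) cell_slice Z c x) ->
  (\int[@completed_lebesgue_measure R]_x (h x)%:E = (\sum_(c | S c) p c)%:E)%E.
Proof.
move=> /choice[lo /choice[hi lohi]] hE.
have int_sum (f : 'I_k.+1 * 'I_k.+1 -> measurableTypeR R -> R) :
    (forall c, measurable_fun setT (f c)) -> (forall c x, 0 <= f c x) ->
    (forall c, (\int[lebesgue_measure]_x (f c x)%:E = (p c)%:E)%E) ->
    (\int[@completed_lebesgue_measure R]_x (\sum_(c | S c) f c x)%:E =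
     (\sum_(c | S c) p c)%:E)%E.
  move=> mf f0 fp; rewrite ge0_integral_completed_lebesgue; last 2 first.
  - by apply/measurable_EFinP; under eq_fun do rewrite -big_filter; exact: measurable_sum.
  - by move=> x; rewrite lee_fin sumr_ge0.
  under eq_integral do rewrite -big_filter -sumEFin.
  rewrite ge0_integral_sum//; last 2 first.
  - by move=> c; exact/measurable_EFinP.
  - by move=> c x _; rewrite lee_fin.
  by rewrite -[in RHS]big_filter -sumEFin; apply: eq_bigr => c _.
have lo0 c x : 0 <= lo c x by case: (lohi c) => _ _ /(_ x)[].
have lo_le c x : lo c x <= cell_slice Z c x.
  by case: (lohi c) => _ _ /(_ x)[_ /andP[]].
have le_hi c x : cell_slice Z c x <= hi c x.
  by case: (lohi c) => _ _ /(_ x)[_ /andP[]].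
apply/eqP; rewrite eq_le; apply/andP; split.
- rewrite -(int_sum hi); last 3 first.
  + by move=> c; case: (lohi c).
  + by move=> c x; exact: le_trans (lo0 _ _) (le_trans (lo_le _ _) (le_hi _ _)).
  + by move=> c; case: (lohi c).
  apply: le_lower_integral => x _; rewrite hE lee_fin.
    by apply: sumr_ge0 => c _; exact: le_trans (lo0 _ _) (lo_le _ _).
  by apply: ler_sum => c _.
- rewrite -(int_sum lo)//; last 2 first.
  + by move=> c; case: (lohi c).
  + by move=> c; case: (lohi c).
  apply: le_lower_integral => x _; rewrite ?hE lee_fin; first exact: sumr_ge0.
  by apply: ler_sum => c _.
Qed.

Lemma sum_fst k (F : 'I_k.+1 * 'I_k.+1 -> R) a :
  \sum_(c | c.1 == a) F c = \sum_b F (a, b).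
Proof.
rewrite (reindex (fun b => (a, b))) /=; last first.
  by exists snd => [b _//|[a' b]]; rewrite inE/= => /eqP->.
by apply: eq_bigl => b; rewrite eqxx.
Qed.

(** The slices above a fixed x telescope to Z x 1 - Z x 0 = 1. *)
Lemma cell_masses_row Z k (p : 'I_k.+1 * 'I_k.+1 -> R) a :
  limit_permutation Z -> cell_masses Z p ->
  \sum_(c | c.1 == a) p c = k.+1%:R^-1.
Proof.
move=> Zlim pZ; apply/EFin_inj.
have h x : \1_(cell k a : set R) x = \sum_(c | c.1 == a) cell_slice Z c x.
  rewrite sum_fst; under [RHS]eq_bigr do rewrite /cell_slice/=.
  rewrite -mulr_sumr indicE.
  case: (boolP (_ \in _)) => [/set_mem xa|_]; last by rewrite mul0r.
  have x01 : 0 <= x <= 1 by apply: cell_sub01 xa; rewrite -ltnS ltn_ord.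
  rewrite mul1r -(big_mkord xpredT (fun i => Z x (i.+1%:R / k.+1%:R) - Z x (i%:R / k.+1%:R))).
  rewrite telescope_sumr// divff ?pnatr_eq0// mul0r.
  rewrite (limit_permutation1 Zlim x01).
  by rewrite (cdf0 (limit_permutation_cdf Zlim x01)) subr0.
rewrite -(integral_cell_masses pZ h) ge0_integral_completed_lebesgue; last 2 first.
- by apply/measurable_EFinP; apply: measurable_indic; exact: measurable_cell.
- by move=> x; rewrite lee_fin.
rewrite integral_indic//; last exact: measurable_cell.
by rewrite setIT; exact: lebesgue_cell.
Qed.

(* The slices below height y = b / k.+1 telescope to Z x y, whose integral over
   x is y. *)
Let sum_below Z k (p : 'I_k.+1 * 'I_k.+1 -> R) (b : nat) :
  limit_permutation Z -> cell_masses Z p -> (b <= k.+1)%N ->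
  \sum_(c : 'I_k.+1 * 'I_k.+1 | (c.2 < b)%N) p c = b%:R / k.+1%:R.
Proof.
move=> Zlim pZ bk; apply/EFin_inj.
have y01 : 0 <= (b%:R / k.+1%:R : R) <= 1.
  by rewrite divr_ge0//= ler_pdivrMr// mul1r ler_nat.
have h x : ((fun x => Z x (b%:R / k.+1%:R)) \_ `[0, 1]) x =
    \sum_(c : 'I_k.+1 * 'I_k.+1 | (c.2 < b)%N) cell_slice Z c x.
  rewrite patchE; case: ifPn => [/set_mem|/negP xN]; last first.
    rewrite big1// => c _; rewrite /cell_slice indicE memNset ?mul0r// => xc.
    apply: xN; apply/mem_set; rewrite /= in_itv/=.
    by apply: cell_sub01 xc; rewrite -ltnS ltn_ord.
  rewrite /= in_itv/= => x01; have [a xa] := cell_cover k x01.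
  under eq_bigr do rewrite /cell_slice (indic_cell _ xa).
  rewrite (bigID (fun c => c.1 == a))/= [X in _ + X]big1 ?addr0; last first.
    by move=> c /andP[_ /negbTE->]; rewrite mul0r.
  under eq_bigr => c /andP[_ ->] do rewrite mul1r.
  under eq_bigl do rewrite andbC.
  rewrite big_mkcondr/= sum_fst/= -big_mkcond/=.
  rewrite (big_ord_narrow bk)/=.
  rewrite -(big_mkord xpredT (fun i => Z x (i.+1%:R / k.+1%:R) - Z x (i%:R / k.+1%:R))).
  by rewrite telescope_sumr// mul0r (cdf0 (limit_permutation_cdf Zlim x01)) subr0.
rewrite -(integral_cell_masses pZ h) -(limit_permutation_uniform Zlim y01).
rewrite [RHS]integral_mkcond; apply: eq_integral => x _.
by rewrite !patchE; case: ifP.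
Qed.

Lemma cell_masses_col Z k (p : 'I_k.+1 * 'I_k.+1 -> R) b :
  limit_permutation Z -> cell_masses Z p ->
  \sum_(c | c.2 == b) p c = k.+1%:R^-1.
Proof.
move=> Zlim pZ.
have := sum_below Zlim pZ (ltn_ord b).
rewrite (bigID (fun c : 'I_k.+1 * 'I_k.+1 => c.2 == b))/=.
rewrite (eq_bigl (fun c : 'I_k.+1 * 'I_k.+1 => c.2 == b)); last first.
  by move=> c /=; rewrite andbC; case: eqP => // ->; rewrite ltnSn.
rewrite [X in _ + X](eq_bigl (fun c : 'I_k.+1 * 'I_k.+1 => (c.2 < b)%N)); last first.
  by move=> c /=; rewrite -val_eqE /= ltnS [in RHS]ltn_neqAle andbC.
rewrite (sum_below Zlim pZ (ltnW (ltn_ord b))) => E.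
by apply: (addIr (b%:R / k.+1%:R)); rewrite E -natr1 mulrDl mul1r addrC.
Qed.

(** Off a null set N the slice is Borel. Set it to 0 on N for the lower function
    and to 1 for the upper one; a slice lies between these values. *)
Lemma cell_masses_exist Z k : limit_permutation Z ->
  exists p : 'I_k.+1 * 'I_k.+1 -> R, cell_masses Z p.
Proof.
move=> Zlim.
suff H (c : 'I_k.+1 * 'I_k.+1) : exists pc : R, exists lo hi : measurableTypeR R -> measurableTypeR R,
    [/\ measurable_fun setT lo, measurable_fun setT hi,
        forall x, 0 <= lo x /\ lo x <= cell_slice Z c x <= hi x,
        (\int[lebesgue_measure]_x (lo x)%:E = pc%:E)%E &
        (\int[lebesgue_measure]_x (hi x)%:E = pc%:E)%E].
  by have [p pP] := choice H; exists p.
have y1 : 0 <= (c.2%:R / k.+1%:R : R) <= 1.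
  by rewrite divr_ge0//= ler_pdivrMr// mul1r ler_nat ltnW.
have y2 : 0 <= (c.2.+1%:R / k.+1%:R : R) <= 1.
  by rewrite divr_ge0//= ler_pdivrMr// mul1r ler_nat.
have [N1 [mN1 N10 mZ1]] := limit_permutation_section Zlim y1.
have [N2 [mN2 N20 mZ2]] := limit_permutation_section Zlim y2.
pose N := N1 `|` N2; have mN : measurable N by exact: measurableU.
have N0 : lebesgue_measure N = 0%E.
  by apply/negligibleP => //; apply: negligibleU; apply/negligibleP.
pose D : set (measurableTypeR R) := `[0, 1] `\` N.
have mD : measurable D by exact: measurableD.
have s01 x : 0 <= cell_slice Z c x <= 1.
  have [x01|x01] := pselect (0 <= x <= 1); last by rewrite cell_slice_out// lexx ler01.
  rewrite cell_slice_ge0; last exact: limit_permutation_cdf Zlim.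
  have /andP[_ le2] := cdf_itv (limit_permutation_cdf Zlim x01) y2.
  have /andP[ge1 _] := cdf_itv (limit_permutation_cdf Zlim x01) y1.
  have d1 : Z x (c.2.+1%:R / k.+1%:R) - Z x (c.2%:R / k.+1%:R) <= 1 by lra.
  by rewrite /= /cell_slice indicE; case: (x \in _); rewrite /= ?mul1r ?mul0r ?ler01.
pose lo : measurableTypeR R -> measurableTypeR R := fun x => (cell_slice Z c \_ D) x.
pose hi : measurableTypeR R -> measurableTypeR R := fun x => lo x + \1_N x.
have mlo : measurable_fun setT lo.
  apply: (measurable_restrictT _ mD).1.
  apply: (@measurable_funM _ (measurableTypeR R) R D (\1_(cell k c.1))
    (fun x => Z x (c.2.+1%:R / k.+1%:R) - Z x (c.2%:R / k.+1%:R))).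
    by apply: measurable_indic; exact: measurable_cell.
  apply: measurable_funB.
    by apply: measurable_funS mZ2 => //; [exact: measurableD|apply: setDS => x; right].
  by apply: measurable_funS mZ1 => //; [exact: measurableD|apply: setDS => x; left].
have mind : measurable_fun setT (\1_N : measurableTypeR R -> R) by exact: measurable_indic.
have mhi : measurable_fun setT hi by exact: measurable_funD.
have lo0 x : 0 <= lo x.
  by rewrite /lo patchE; case: ifP => // _; case/andP: (s01 x).
have inthi : (\int[lebesgue_measure]_x (hi x)%:E = \int[lebesgue_measure]_x (lo x)%:E)%E.
  under eq_integral do rewrite EFinD.
  rewrite ge0_integralD//; last 3 first.
  - by move=> x _; rewrite lee_fin.
  - exact/measurable_EFinP.
  - exact/measurable_EFinP.
  by rewrite integral_indic// setIT [X in (_ + X)%E]N0 adde0.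
have fin : (\int[lebesgue_measure]_x (lo x)%:E)%E \is a fin_num.
  have int0 : (0 <= \int[lebesgue_measure]_x (lo x)%:E)%E.
    by apply: integral_ge0 => x _; rewrite lee_fin.
  rewrite (ge0_fin_numE int0).
  apply: (@le_lt_trans _ _ (\int[lebesgue_measure]_x (\1_`[0, 1]%classic x)%:E)%E).
    apply: le_lower_integral => x _; rewrite lee_fin; first exact: lo0.
    rewrite /lo patchE indicE.
    case: ifPn => [/set_mem[x01 _]|]//; rewrite mem_set//.
    by case/andP: (s01 x).
  by rewrite integral_indic// setIT [X in (X < _)%E]lebesgue_measure01 ltry.
exists (fine (\int[lebesgue_measure]_x (lo x)%:E)%E), lo, hi; split => //.
- move=> x; split => //; rewrite /hi /lo patchE.
  case: ifPn => [/set_mem[x01 nN]|/negP nD]; first by rewrite lexx/= lerDl indicE.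
  rewrite add0r; have /andP[-> s1]/= := s01 x.
  have [x01|x01] := pselect (0 <= x <= 1).
    rewrite indicE mem_set//; apply: contrapT => nN; apply: nD; apply/mem_set.
    by split => //=; rewrite in_itv.
  by rewrite cell_slice_out.
- by rewrite fineK.
- by rewrite inthi fineK.
Qed.

End cell_masses_of_limit_permutation.

(** * Every limit permutation is a limit of permutations *)

Section realization.
Variable R : realType.

Definition density_bound (tau : permutation) : R :=
  let m := plength tau in (m * m)%:R + m`!%:R * (m%:R + (4 * m * m)%:R).

(** With K = k.+1, round down 2 K ^ 3 times the cell masses. Rounding loses less
    than one point in each of the K ^ 2 cells, so at least K ^ 3 points remain,
    and the l1 distance of the frequencies to the masses is at most
    2 K ^ 2 / K ^ 3. *)
Lemma realizing_permutation (Z : R -> R -> R) k : limit_permutation Z ->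
  exists pi : permutation, forall tau : permutation, (plength tau <= k.+1)%N ->
    `|density R tau pi - limit_density tau Z| <= density_bound tau * (2 / k.+1%:R).
Proof.
move=> Zlim; have [p pZ] := cell_masses_exist k Zlim.
set K := k.+1; have K0 : 0 < K%:R :> R by rewrite ltr0n.
pose N0 := (2 * K ^ 3)%N; pose c u := Num.truncn (N0%:R * p u).
have p0 u : 0 <= p u by exact: cell_masses_ge0 pZ.
have p1 : \sum_u p u = 1.
  rewrite (partition_big (fun c => c.1) xpredT)//=.
  under eq_bigr do rewrite (cell_masses_row _ Zlim pZ).
  by rewrite sumr_const card_ord -[_ *+ _]mulr_natr mulVf// pnatr_eq0.
have cle u : (c u)%:R <= N0%:R * p u.
  by have /andP[] := truncn_itv (mulr_ge0 (ler0n R N0) (p0 u)).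
have cgt u : N0%:R * p u - 1 <= (c u)%:R.
  have /andP[_ /ltW] := truncn_itv (mulr_ge0 (ler0n R N0) (p0 u)).
  by rewrite -/(c u) -natr1; lra.
set N := (\sum_u c u)%N.
have cardKK : #|{: 'I_K * 'I_K}| = (K * K)%N by rewrite card_prod card_ord.
have NE : N%:R = \sum_u (c u)%:R :> R by rewrite natr_sum.
have N0p : N0%:R = \sum_u N0%:R * p u by rewrite -mulr_sumr p1 mulr1.
have Nle : N%:R <= N0%:R :> R.
  by rewrite NE N0p ler_sum.
have Nge : N0%:R - (K * K)%:R <= N%:R :> R.
  rewrite NE N0p -cardKK -sumr_const -sumrB.
  exact: ler_sum.
have N0E : N0%:R = 2 * K%:R ^+ 3 :> R by rewrite natrM natrX.
have K1 : 1 <= K%:R :> R by rewrite ler1n.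
have NK : K%:R ^+ 3 <= N%:R :> R.
  move: Nge; rewrite N0E natrM -expr2.
  have : K%:R ^+ 2 <= K%:R ^+ 3 :> R by rewrite ler_weXn2l.
  lra.
have N_gt0 : 0 < N%:R :> R by apply: lt_le_trans NK; rewrite exprn_gt0.
have KN : K%:R <= N%:R :> R.
  by apply: le_trans NK; rewrite -[leLHS]expr1 ler_weXn2l.
have [pi [piN [al [be [al_mono be_mono countE]]]]] :
  exists pi : permutation, plength pi = N /\
    exists al be : 'I_(plength pi) -> 'I_K,
      [/\ {homo al : i j / (i <= j)%N}, {homo be : i j / (i <= j)%N} &
          forall u, cell_count al be u = c u].
  by apply: permutation_with_counts; rewrite -(ltr_nat R).
exists pi => tau mK.
apply: (density_close (limit_permutation_cdf Zlim) (limit_permutation1 Zlim) pZ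
  (fun a => cell_masses_row a Zlim pZ) (fun b => cell_masses_col b Zlim pZ)
  al_mono be_mono).
- by rewrite piN -(ler_nat R); apply: le_trans KN; rewrite ler_nat.
- rewrite piN; apply: (@le_trans _ _ K%:R^-1); first by rewrite lef_pV2.
  by rewrite ler_peMl ?invr_ge0// ?ltW//; lra.
- by rewrite ler_peMl ?invr_ge0// ?ltW//; lra.
have dist u : `|cell_freq R al be u - p u| <= (1 + (K * K)%:R * p u) / N%:R.
  rewrite /cell_freq countE piN ler_pdivlMr//.
  rewrite -[X in _ * X](gtr0_norm N_gt0) -normrM mulrBl divfK ?gt_eqF//.
  have := cle u; have := cgt u; have := p0 u.
  have h1 : N%:R * p u <= N0%:R * p u by rewrite ler_wpM2r.
  have h2 : (N0%:R - (K * K)%:R) * p u <= N%:R * p u by rewrite ler_wpM2r.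
  rewrite mulrBl in h2; have h3 : 0 <= (K * K)%:R * p u by rewrite mulr_ge0.
  by rewrite (mulrC (p u)) ler_norml => *; apply/andP; split; lra.
apply: (le_trans (ler_sum _ (fun u _ => dist u))).
rewrite -mulr_suml big_split/= -mulr_sumr p1 mulr1 sumr_const cardKK.
rewrite ler_pdivrMr// mulrAC ler_pdivlMr//.
rewrite natrM.
apply: (@le_trans _ _ (2 * K%:R ^+ 3)); last by rewrite ler_wpM2l.
by rewrite le_eqVlt; apply/orP; left; apply/eqP; ring.
Qed.

Lemma limit_permutation_is_limit (Z : R -> R -> R) : limit_permutation Z ->
  exists sigma : nat -> permutation, forall tau : permutation,
    density R tau (sigma n) @[n --> \oo] --> limit_density tau Z.
Proof.
move=> Zlim.
have [sigma sigmaP] := choice (fun k => realizing_permutation k Zlim).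
exists sigma => tau; apply/cvgrPdist_le => e e0.
have C0 : 0 <= density_bound tau by rewrite addr_ge0// mulr_ge0.
have e'0 : 0 < e / (2 * (density_bound tau + 1)) by rewrite divr_gt0// mulr_gt0// ltr_wpDl.
near=> n; rewrite distrC.
apply: le_trans (sigmaP n tau _) _; first by near: n; exact: nbhs_infty_ge.
have : n.+1%:R^-1 < e / (2 * (density_bound tau + 1)).
  by near: n; exact: (near_infty_natSinv_lt (PosNum e'0)).
rewrite ltr_pdivlMr; last by rewrite mulr_gt0// ltr_wpDl.
move: (n.+1%:R^-1) (invr_ge0 (n.+1%:R : R)) => i; rewrite ler0n => i0.
nra.
Unshelve. all: by end_near. Qed.

End realization.

(** * Limits of empirical distribution functions *)

Section ultralimit.
Variable R : realType.

Lemma ultrafilter_cvg (T : pointedType) (U : set_system T) (u : T -> R) (a b : R) :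
  UltraFilter U -> (forall t, a <= u t <= b) -> exists l : R, u t @[t --> U] --> l.
Proof.
move=> UU uab.
have /(_ (u @ U) _ _)[|l [_ cl]] := @segment_compact R a b.
  have : U (u @^-1` `[a, b]) by apply: filterE => t; rewrite /= in_itv/=.
  by [].
exists l => V Vl; have [//|UnV] := in_ultra_setVsetC (u @^-1` V) UU.
by have [x []] := cl (~` V) V UnV Vl.
Qed.

End ultralimit.

Section count.
Variable R : realType.

(** The indicator of i < z is at least the increment of min(., z) from i to i + 1
    and at most that of min(., z + 1); the increments telescope. *)
Lemma count_below (N : nat) (z : R) : 0 <= z <= N%:R ->
  z <= \sum_(i < N) ((i%:R < z)%R%:R : R) <= z + 1.
Proof.
move=> /andP[z0 zN].
have telescope c : \sum_(i < N) (Num.min (i.+1%:R : R) c - Num.min (i%:R : R) c) =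
    Num.min (N%:R : R) c - Num.min 0 c.
  rewrite -(big_mkord xpredT (fun i => Num.min (i.+1%:R : R) c - Num.min (i%:R : R) c)).
  by rewrite telescope_sumr.
apply/andP; split.
  apply: (@le_trans _ _ (Num.min (N%:R : R) z - Num.min 0 z)).
    by rewrite (min_r zN) (min_l z0) subr0.
  rewrite -telescope; apply: ler_sum => i _; rewrite -natr1.
  case: (ltrP (i%:R : R) z) => iz /=.
    by rewrite lerBlDl ge_min lexx.
  by rewrite (min_r (le_trans iz _)) ?subrr// lerDl.
apply: (@le_trans _ _ (Num.min (N%:R : R) (z + 1) - Num.min 0 (z + 1))).
  rewrite -telescope; apply: ler_sum => i _; rewrite -natr1.
  case: (ltrP (i%:R : R) z) => iz /=.
    have h1 : i%:R + 1 <= z + 1 by rewrite lerD2r ltW.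
    by rewrite (min_l h1) (min_l (le_trans _ h1)) ?lerDl// addrAC subrr add0r.
  by rewrite subr_ge0 le_min !ge_min lexx lerDl ler01 !orbT.
by rewrite (min_l (addr_ge0 z0 ler01)) subr0 ge_min lexx orbT.
Qed.

End count.

Section empirical.
Variable R : realType.
Implicit Type pi : permutation.

(** The distribution function of the uniform probability on the points
    (i / N, pi i / N). *)
Definition empirical pi (x y : R) : R :=
  (\sum_(i < plength pi)
     (i%:R < x * (plength pi)%:R)%R%:R * ((pfun pi i)%:R < y * (plength pi)%:R)%R%:R)
  / (plength pi)%:R.

Let N_gt0 pi : 0 < (plength pi)%:R :> R. Proof. exact: ltr0Sn. Qed.

Let below_mono pi (x x' : R) (i : nat) : x <= x' ->
  ((i%:R < x * (plength pi)%:R)%R%:R : R) <= (i%:R < x' * (plength pi)%:R)%R%:R.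
Proof.
move=> xx'; rewrite ler_nat; case: (ltrP _ (x * _)) => //= ix.
by rewrite (lt_le_trans ix)// ler_wpM2r.
Qed.

Lemma empirical_rect pi x x' y y' : x <= x' -> y <= y' ->
  0 <= empirical pi x' y' - empirical pi x y' - empirical pi x' y + empirical pi x y.
Proof.
move=> xx' yy'; rewrite /empirical -!mulNr -!mulrDl divr_ge0//.
rewrite -!sumrN -!big_split/= sumr_ge0// => i _.
have := below_mono pi i xx'; have := below_mono pi (pfun pi i) yy'.
move: ((i%:R < _)%R%:R) ((i%:R < _)%R%:R) (((pfun pi i)%:R < _)%R%:R) (((pfun pi i)%:R < _)%R%:R).
by move=> a b c d dc ba; nra.
Qed.

Lemma empirical0 pi x y : x <= 0 \/ y <= 0 -> empirical pi x y = 0.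
Proof.
move=> xy; rewrite /empirical big1 ?mul0r// => i _.
have neg (z : R) (j : nat) : z <= 0 -> (j%:R < z * (plength pi)%:R) = false.
  move=> z0; apply/negbTE; rewrite -leNgt; apply: le_trans (ler0n _ _).
  by rewrite mulr_le0_ge0.
by case: xy => /neg ->; rewrite ?mul0r ?mulr0.
Qed.

Lemma empirical_ge0 pi x y : 0 <= empirical pi x y.
Proof. by rewrite divr_ge0// sumr_ge0. Qed.

Lemma empirical_le1 pi x y : empirical pi x y <= 1.
Proof.
rewrite ler_pdivrMr// mul1r.
apply: (@le_trans _ _ (\sum_(i < plength pi) 1)); last by rewrite sumr_const card_ord.
by apply: ler_sum => i _; case: (_ < _); case: (_ < _); rewrite ?mul0r ?mulr0 ?mul1r.
Qed.

Lemma empirical_x1 pi x : 0 <= x <= 1 ->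
  `|empirical pi x 1 - x| <= (plength pi)%:R^-1.
Proof.
move=> /andP[x0 x1].
have : 0 <= x * (plength pi)%:R <= (plength pi)%:R.
  by rewrite mulr_ge0//= ler_piMl.
move=> /count_below/andP[l u].
have E : empirical pi x 1 * (plength pi)%:R =
    \sum_(i < plength pi) ((i%:R < x * (plength pi)%:R)%R%:R : R).
  rewrite divfK ?gt_eqF//; apply: eq_bigr => i _.
  by rewrite mul1r ltr_nat ltn_ord mulr1.
rewrite -(ler_pM2r (N_gt0 pi)) mulVf ?gt_eqF// -(gtr0_norm (N_gt0 pi)) -normrM.
by rewrite mulrBl E ger0_norm ?subr_ge0// lerBlDl.
Qed.

Lemma empirical_1y pi y : 0 <= y <= 1 ->
  `|empirical pi 1 y - y| <= (plength pi)%:R^-1.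
Proof.
move=> /andP[y0 y1].
have : 0 <= y * (plength pi)%:R <= (plength pi)%:R.
  by rewrite mulr_ge0//= ler_piMl.
move=> /count_below/andP[l u].
have E : empirical pi 1 y * (plength pi)%:R =
    \sum_(i < plength pi) ((i%:R < y * (plength pi)%:R)%R%:R : R).
  rewrite divfK ?gt_eqF// [RHS](reindex_inj (@perm_inj _ (pfun pi))).
  apply: eq_bigr => i _.
  by rewrite mul1r ltr_nat ltn_ord mul1r.
rewrite -(ler_pM2r (N_gt0 pi)) mulVf ?gt_eqF// -(gtr0_norm (N_gt0 pi)) -normrM.
by rewrite mulrBl E ger0_norm ?subr_ge0// lerBlDl.
Qed.

(** The index of the cell that contains i / N. *)
Definition grid_colour pi k (i : 'I_(plength pi)) : 'I_k.+1 :=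
  inord (i * k.+1 %/ plength pi).

Lemma grid_colour_mono pi k : {homo grid_colour (pi := pi) k : i j / (i <= j)%N}.
Proof.
move=> i j ij; rewrite !inordK ?ltn_divLR// ?[(_ * plength pi)%N]mulnC ?ltn_pmul2r//.
by apply: leq_div2r; rewrite leq_mul2r ij orbT.
Qed.

Let grid_colourE pi k (a : 'I_k.+1) (i : 'I_(plength pi)) :
  ((grid_colour k i == a)%:R : R) =
  ((i%:R : R) < a.+1%:R / k.+1%:R * (plength pi)%:R)%R%:R -
  ((i%:R : R) < a%:R / k.+1%:R * (plength pi)%:R)%R%:R.
Proof.
have ltE (b : nat) : ((i%:R : R) < b%:R / k.+1%:R * (plength pi)%:R) =
    (i * k.+1 %/ plength pi < b)%N.
  by rewrite mulrAC ltr_pdivlMr// -!natrM ltr_nat ltn_divLR.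
rewrite !ltE -val_eqE/= inordK; last first.
  by rewrite ltn_divLR// mulnC ltn_pmul2l.
by rewrite ltnS; case: ltngtP; rewrite ?subrr ?subr0.
Qed.

(** The mass of a grid cell under the measure with distribution function F. *)
Definition rect_diff (F : R -> R -> R) k (c : 'I_k.+1 * 'I_k.+1) : R :=
  F (c.1.+1%:R / k.+1%:R) (c.2.+1%:R / k.+1%:R) -
  F (c.1%:R / k.+1%:R) (c.2.+1%:R / k.+1%:R) -
  F (c.1.+1%:R / k.+1%:R) (c.2%:R / k.+1%:R) +
  F (c.1%:R / k.+1%:R) (c.2%:R / k.+1%:R).

Lemma cell_freq_grid pi k c :
  cell_freq R (@grid_colour pi k) (@grid_colour pi k) c = rect_diff (empirical pi) c.
Proof.
rewrite /rect_diff /empirical -!mulNr -!mulrDl /cell_freq; congr (_ / _).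
rewrite -!sumrN -!big_split/= /cell_count -sum1_card natr_sum big_mkcond/=.
apply: eq_bigr => i _.
transitivity ((grid_colour k i == c.1)%:R * (grid_colour k (pfun pi i) == c.2)%:R : R).
  rewrite inE -pair_eqE/=.
  by case: (_ == _); case: (_ == _); rewrite ?mul0r ?mulr0 ?mul1r.
rewrite !grid_colourE; ring.
Qed.

(** On the unit square: the distribution functions of probabilities with uniform
    marginals. *)
Record copula (F : R -> R -> R) : Prop := {
  copula_rect : forall x x' y y', x <= x' -> y <= y' ->
    0 <= F x' y' - F x y' - F x' y + F x y;
  copula0y : forall y, F 0 y = 0;
  copulax0 : forall x, F x 0 = 0;
  copula1y : forall y, 0 <= y <= 1 -> F 1 y = y;
  copulax1 : forall x, 0 <= x <= 1 -> F x 1 = x }.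

(** Along an ultrafilter a bounded sequence converges, so all points (x, y) are
    treated at once without extracting subsequences. The marginals of the
    empirical functions are uniform up to 1 / N, which tends to 0. *)
Lemma copula_ultralimit (sigma : nat -> permutation) :
  plength (sigma n) @[n --> \oo] --> \oo ->
  exists U : set_system nat, [/\ ProperFilter U, \oo `<=` U & exists2 F, copula F &
    forall x y, empirical (sigma n) x y @[n --> U] --> F x y].
Proof.
move=> sigma_oo; have [U [UU ooU]] := ultraFilterLemma (eventually_filter).
exists U; split => //; first exact: ultra_proper.
have PU : ProperFilter U by exact: ultra_proper.
have lim (p : R * R) : exists l : R, empirical (sigma n) p.1 p.2 @[n --> U] --> l.
  apply: (@ultrafilter_cvg _ _ _ _ 0 1) => n.
  by rewrite empirical_ge0 empirical_le1.
have [F FP] := choice lim.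
have F_eq x y (l : R) : empirical (sigma n) x y @[n --> U] --> l -> F (x, y) = l.
  move=> el; rewrite -(cvg_lim (@Rhausdorff R) (FP (x, y))).
  exact: (cvg_lim (@Rhausdorff R)).
have inv0 : (plength (sigma n))%:R^-1 @[n --> U] --> (0 : R).
  apply/cvgrPdist_le => e e0; apply: ooU.
  move: sigma_oo => /cvgnyPge/(_ (Num.truncn e^-1).+1).
  apply: filterS => n; rewrite -(ler_nat R) => en.
  rewrite sub0r normrN ger0_norm ?invr_ge0// invf_ple ?posrE//.
  have ei0 : 0 <= e^-1 by rewrite invr_ge0 ltW.
  by apply: le_trans en; apply: ltW; have /andP[] := truncn_itv ei0.
exists (fun x y => F (x, y)); last by move=> x y; exact: FP (x, y).
have squeeze x y (l : R) :
    (forall n, `|empirical (sigma n) x y - l| <= (plength (sigma n))%:R^-1) -> F (x, y) = l.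
  move=> el; apply: F_eq; apply/cvgrPdist_le => e e0.
  move: inv0 => /cvgrPdist_le/(_ e e0); apply: filterS => n.
  rewrite sub0r normrN ger0_norm ?invr_ge0// distrC; exact: le_trans.
split.
- move=> x x' y y' xx' yy'.
  have H := cvgD (cvgB (cvgB (FP (x', y')) (FP (x, y'))) (FP (x', y))) (FP (x, y)).
  apply: (@closed_cvg _ _ U _ _ (fun t : R => 0 <= t) _ _ _ (H _ _ _)); first exact: closed_ge.
  by apply: nearW => n; exact: empirical_rect.
- by move=> y; apply: squeeze => n; rewrite empirical0 ?subrr ?normr0 ?invr_ge0//; left.
- by move=> x; apply: squeeze => n; rewrite empirical0 ?subrr ?normr0 ?invr_ge0//; right.
- by move=> y y01; apply: squeeze => n; exact: empirical_1y.
- by move=> x x01; apply: squeeze => n; exact: empirical_x1.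
Qed.

End empirical.

(** * Densities of a copula at a fixed height *)

Section copula_facts.
Variables (R : realType) (F : R -> R -> R).
Hypothesis cF : copula F.

Lemma copula_incr_x x x' y : x <= x' -> 0 <= y -> F x y <= F x' y.
Proof.
move=> xx' y0; have := copula_rect cF xx' y0.
by rewrite !(copulax0 cF); lra.
Qed.

Lemma copula_rect_le x x' y y' : x <= x' -> y <= y' ->
  F x' y - F x y <= F x' y' - F x y'.
Proof. by move=> xx' yy'; have := copula_rect cF xx' yy'; lra. Qed.

Lemma copula_lip_x x x' y : 0 <= x -> x <= x' -> x' <= 1 -> y <= 1 ->
  F x' y - F x y <= x' - x.
Proof.
move=> x0 xx' x1 y1; have := copula_rect_le xx' y1.
have h : 0 <= x <= 1 by rewrite x0 (le_trans xx').
have h' : 0 <= x' <= 1 by rewrite x1 (le_trans x0).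
by rewrite (copulax1 cF h) (copulax1 cF h').
Qed.

Lemma copula_lip_y x y y' : 0 <= x <= 1 -> 0 <= y -> y <= y' -> y' <= 1 ->
  0 <= F x y' - F x y <= y' - y.
Proof.
move=> /andP[x0 x1] y0 yy' y1.
have := copula_rect cF x1 yy'; have := copula_rect cF x0 yy'.
have h : 0 <= y <= 1 by rewrite y0 (le_trans yy').
have h' : 0 <= y' <= 1 by rewrite y1 (le_trans y0).
rewrite !(copula0y cF) (copula1y cF h) (copula1y cF h').
by move=> *; apply/andP; split; lra.
Qed.

End copula_facts.

Section copula_density.
Variables (R : realType) (F : R -> R -> R) (q : R).
Hypotheses (cF : copula F) (q0 : 0 < q) (q1 : q <= 1).
Local Notation lambda := (@lebesgue_measure R).

Definition clip (x : R) : R := Num.max 0 (Num.min x 1).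

Lemma clip_id x : 0 <= x <= 1 -> clip x = x.
Proof. by move=> /andP[x0 x1]; rewrite /clip min_l// max_r. Qed.

Lemma clip01 x : 0 <= clip x <= 1.
Proof. by rewrite le_max lexx ge_max ler01 ge_min lexx orbT. Qed.

Lemma clip_mono x x' : x <= x' -> clip x <= clip x'.
Proof.
move=> xx'; rewrite /clip ge_max !le_max lexx/= le_min !ge_min lexx xx' orbT.
by rewrite orbT.
Qed.

Lemma clip_lip x x' : x <= x' -> clip x' - clip x <= x' - x.
Proof.
move=> xx'; rewrite /clip /Num.max /Num.min; do ! case: ifP; move=> *; lra.
Qed.

Let H x := F (clip x) q / q.

Let H_nd : {homo H : x y / x <= y}.
Proof.
move=> x y xy; rewrite ler_wpM2r ?invr_ge0 ?(ltW q0)//.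
by apply: copula_incr_x => //; [exact: clip_mono|exact: ltW].
Qed.

Let H_lip x y : x <= y -> H y - H x <= (y - x) / q.
Proof.
move=> xy; rewrite -mulrBl ler_wpM2r ?invr_ge0 ?(ltW q0)//.
apply: le_trans (clip_lip xy); case/andP: (clip01 x) => ? ?; case/andP: (clip01 y) => ? ?.
exact: copula_lip_x (clip_mono xy) _ _.
Qed.

Let H_rc : right_continuous H.
Proof.
apply/right_continuousW => x; apply/cvgrPdist_le => e e0.
near=> y.
have h : `|x - y| <= e * q.
  near: y; have := @cvg_id _ (nbhs x); move/cvgrPdist_le; apply.
  by rewrite mulr_gt0.
rewrite -ler_pdivrMr// in h; apply: le_trans h.
have [xy|/ltW yx] := leP x y.
  rewrite distrC (distrC x) !ger0_norm ?subr_ge0 ?H_lip ?H_nd//.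
by rewrite !ger0_norm ?subr_ge0 ?H_lip ?H_nd.
Unshelve. all: by end_near. Qed.

#[local] HB.instance Definition _ := isCumulative.Build R _ R H H_nd H_rc.

Let H_Ny : H @ -oo --> (0 : R).
Proof.
apply: cvg_near_cst; near=> x; rewrite /H /clip.
have x0 : x <= 0 by near: x; exact: nbhs_ninfty_le.
by rewrite max_l ?ge_min ?x0// (copula0y cF) mul0r.
Unshelve. all: by end_near. Qed.

Let H_y : H @ +oo --> (1 : R).
Proof.
apply: cvg_near_cst; near=> x; rewrite /H /clip.
have x1 : 1 <= x by near: x; exact: nbhs_pinfty_ge.
by rewrite min_r// max_r// (copula1y cF) ?divff ?gt_eqF// ltW.
Unshelve. all: by end_near. Qed.

#[local] HB.instance Definition _ := isCumulativeBounded.Build R 0 1 H H_Ny H_y.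

(* H is the distribution function of P, whose mass at the height q is normalized
   to one. *)
Let P : probability (measurableTypeR R) R := lebesgue_stieltjes_measure H.

Let P_itv a b : a <= b -> P `]a, b]%classic = (H b - H a)%:E.
Proof.
move=> ab; rewrite /P/= /lebesgue_stieltjes_measure /measure_extension.
by rewrite measurable_mu_extE/= ?wlength_itv_bnd//; exact: is_ocitv.
Qed.

(* H is Lipschitz with constant 1 / q, so an interval has P-mass at most its
   length divided by q; cover a null set by intervals of small total length. *)
Let P_dominated : P `<< lambda.
Proof.
apply/null_content_dominatesP => A mA A0.
apply/eqP; rewrite -measure_le0; apply/lee_addgt0Pr => e e0; rewrite add0e.
have Afin : ((wlength idfun)^*%mu A) \is a fin_num by rewrite [X in X \is a _]A0.
have eq0 : 0 < e * q by rewrite mulr_gt0.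
have [_ [B [mB AB] <-]] := lb_ereal_inf_adherent eq0 Afin.
move=> /ltW; rewrite -/(mu_ext _ _) [X in (_ <= X + _)%E]A0 add0e => Be.
apply: (@le_trans _ _ (\sum_(k <oo) wlength H (B k))%E).
  by apply: ereal_inf_lbound; exists B.
apply: (@le_trans _ _ (\sum_(k <oo) (q^-1)%:E * wlength idfun (B k))%E).
  apply: lee_nneseries => // k _.
  have [->|[[a b]/= ab ->]] := (ocitvP _).1 (mB k).
    by rewrite !wlength0 mule0.
  rewrite !wlength_itv_bnd ?(ltW ab)//= -?EFinB -EFinM lee_fin mulrC.
  exact/H_lip/ltW.
by rewrite nneseriesZl// lee_pdivrMl// -EFinM mulrC.
Qed.

Let f := Radon_Nikodym_SigmaFinite.f P lambda.
Let h x := fine (f x).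

Let hE x : (h x)%:E = f x.
Proof. by rewrite fineK//; exact: Radon_Nikodym_SigmaFinite.f_fin_num. Qed.

Let h_ge0 x : 0 <= h x.
Proof. by rewrite -lee_fin hE; exact: Radon_Nikodym_SigmaFinite.f_ge0. Qed.

Let h_int : lambda.-integrable setT (EFin \o h).
Proof.
rewrite (_ : EFin \o h = f); first exact: Radon_Nikodym_SigmaFinite.f_integrable.
by apply/funext => x /=; rewrite hE.
Qed.

Let mh : measurable_fun [set: measurableTypeR R] h.
Proof. by move/integrableP: h_int => [/measurable_EFinP]. Qed.

Let int_h A : measurable A -> (\int[lambda]_(x in A) (h x)%:E = P A)%E.
Proof.
move=> mA; rewrite (Radon_Nikodym_SigmaFinite.f_integral P_dominated mA).
by apply: eq_integral => x _; rewrite hE.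
Qed.

Let Phi x := (\int[lambda]_(t in `]-oo, x]) h t)%R.

Let Phi_diff a b : a <= b -> Phi b - Phi a = H b - H a.
Proof.
move=> ab; have fin A : measurable A -> P A \is a fin_num by move=> mA; exact: fin_num_measure.
have E x : (Phi x)%:E = P `]-oo, x]%classic.
  by rewrite /Phi /Rintegral int_h// fineK// fin.
have : P `]-oo, b]%classic = (P `]-oo, a]%classic + P `]a, b]%classic)%E.
  rewrite -measureU//; last first.
    apply/seteqP; split => // x /= []; rewrite !in_itv/= => xa /andP[].
    by rewrite ltNge xa.
  by congr (P _); rewrite -itv_bndbnd_setU// bnd_simp.
by rewrite -!E P_itv// -EFinD => -[->]; rewrite addrAC subrr add0r.
Qed.

Let Phi_derive : {ae lambda, forall x, derivable Phi x 1 /\ Phi^`() x = h x}.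
Proof.
apply: FTC1Ny => [y|].
  by apply: integrableS h_int.
by apply: open_integrable_locally => //; exact: openT.
Qed.

(** The Radon-Nikodym derivative of F(., q). By Lebesgue's differentiation
    theorem it is almost everywhere the right derivative of F(., q); this
    pointwise description is what allows the densities at different heights to
    be compared. *)
Lemma copula_density : exists d : R -> R,
  [/\ measurable_fun [set: measurableTypeR R] d, forall x, 0 <= d x,
      forall a b, 0 <= a -> a <= b -> b <= 1 ->
        (\int[lambda]_(x in `]a, b]) (d x)%:E = (F b q - F a q)%:E)%E &
      {ae lambda, forall x,
        (F (clip (x + t)) q - F (clip x) q) / t @[t --> 0^'+] --> d x}].
Proof.
exists (fun x => q * h x); split.
- exact: measurable_funM.
- by move=> x; rewrite mulr_ge0// ltW.
- move=> a b a0 ab b1.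
  under eq_integral do rewrite EFinM.
  rewrite ge0_integralZl//; last 3 first.
  + by apply/measurable_EFinP; exact: measurable_funTS.
  + by move=> x _; rewrite lee_fin.
  + by rewrite lee_fin ltW.
  rewrite int_h// P_itv// /H -EFinM -mulrBl mulrC divfK ?gt_eqF//.
  by rewrite !clip_id// ?b1 ?a0 ?(le_trans a0)// (le_trans ab).
apply: filterS Phi_derive; first exact: (ae_filter_ringOfSetsType lambda).
move=> x [dx Phix].
have : (fun t => t^-1 *: (Phi (t *: 1 + x) - Phi x)) @ 0^' --> h x.
  by rewrite -Phix derive1E; exact: dx.
move=> /cvg_dnbhs_at_right /(cvgM (cvg_cst q)).
apply: cvg_trans; apply: near_eq_cvg; near=> t.
have t0 : 0 < t by near: t; exact: nbhs_right_gt.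
rewrite /= [t%:A]mulr1 (addrC t) Phi_diff ?lerDl ?(ltW t0)// /H -mulrBl [_ *: _]mulrC; field.
by rewrite !gt_eqF.
Unshelve. all: by end_near. Qed.

End copula_density.

(** * Left-continuous envelope of the densities *)

Section left_envelope.
Variables (R : realType) (g : rat -> R).

(** The supremum of the empty set is 0, which gives the value 0 at y <= 0. *)
Definition left_envelope (y : R) : R :=
  sup [set g q | q in [set q : rat | 0 < (ratr q : R) < y]].

Hypothesis g01 : forall q, 0 < (ratr q : R) <= 1 -> 0 <= g q <= 1.
Hypothesis g_mono : forall q q', 0 < (ratr q : R) -> q <= q' -> (ratr q' : R) <= 1 ->
  g q <= g q'.

Let S (y : R) := [set g q | q in [set q : rat | 0 < (ratr q : R) < y]].

Let S_ub y : y <= 1 -> ubound (S y) 1.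
Proof.
move=> y1 _ [q /andP[q0 qy] <-].
have q01 : 0 < (ratr q : R) <= 1 by rewrite q0 (le_trans (ltW qy)).
by have /andP[] := g01 q01.
Qed.

Let left_envelope_npos y : y <= 0 -> left_envelope y = 0.
Proof.
move=> y0; rewrite /left_envelope (_ : [set _ | _ in _] = set0) ?sup0//.
apply/seteqP; split => // r [q /= /andP[q0 qy]].
by move: (lt_trans q0 qy); rewrite ltNge y0.
Qed.

Lemma left_envelope_ge q y : 0 < (ratr q : R) -> ratr q < y -> y <= 1 ->
  g q <= left_envelope y.
Proof.
move=> q0 qy y1; apply: ub_le_sup; first by exists 1; exact: S_ub.
by exists q => //=; rewrite q0.
Qed.

Let S_n0 y : 0 < y -> S y !=set0.
Proof.
move=> y0; have [q] := rat_in_itvoo y0; rewrite in_itv/= => qy.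
by exists (g q), q.
Qed.

Lemma left_envelope_le q y : y <= ratr q -> (ratr q : R) <= 1 -> 0 < (ratr q : R) ->
  left_envelope y <= g q.
Proof.
move=> yq q1 q0; have [y0|y0] := leP y 0.
  have q01 : 0 < (ratr q : R) <= 1 by rewrite q0.
  by rewrite (left_envelope_npos y0); have /andP[] := g01 q01.
apply: ge_sup; first exact: S_n0.
move=> _ [q' /andP[q'0 q'y] <-]; apply: g_mono => //.
by rewrite -(ler_rat R) ltW// (lt_le_trans q'y).
Qed.

Lemma left_envelope_gt c y : 0 <= c -> c < left_envelope y ->
  exists q, [/\ 0 < (ratr q : R), ratr q < y & c < g q].
Proof.
move=> c0 cy; have [y0|y0] := leP y 0.
  by move: cy; rewrite (left_envelope_npos y0) ltNge c0.
have [_ [q /andP[q0 qy] <-] cq] := sup_gt (S_n0 y0) cy.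
by exists q.
Qed.

Lemma left_envelope0 : left_envelope 0 = 0.
Proof. exact: left_envelope_npos. Qed.

Lemma left_envelope01 y : 0 <= y <= 1 -> 0 <= left_envelope y <= 1.
Proof.
move=> /andP[]; rewrite le_eqVlt => /predU1P[<- _|y0 y1].
  by rewrite left_envelope0 lexx ler01.
apply/andP; split; last by apply: ge_sup; [exact: S_n0|exact: S_ub].
have [_ [q /andP[q0 qy] _]] := S_n0 y0.
apply: le_trans (left_envelope_ge q0 qy y1).
have q01 : 0 < (ratr q : R) <= 1 by rewrite q0 (le_trans (ltW qy)).
by have /andP[] := g01 q01.
Qed.

Lemma left_envelope_mono y z : 0 <= y -> y <= z -> z <= 1 ->
  left_envelope y <= left_envelope z.
Proof.
rewrite le_eqVlt => /predU1P[<- z0 z1|y0 yz z1].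
  have z01 : 0 <= z <= 1 by rewrite z0.
  by rewrite left_envelope0; have /andP[] := left_envelope01 z01.
apply: ge_sup; first exact: S_n0.
move=> _ [q /andP[q0 qy] <-]; apply: left_envelope_ge => //.
exact: lt_le_trans yz.
Qed.

Lemma cdf_left_envelope : Defs.cdf left_envelope.
Proof.
split; [exact: left_envelope01|exact: left_envelope_mono| |exact: left_envelope0].
move=> y /andP[y0 y1]; apply/cvgrPdist_lt => e e0.
have y01 : 0 <= y <= 1 by rewrite ltW.
have [q [q0 qy eq]] : exists q, [/\ 0 < (ratr q : R), ratr q < y & left_envelope y - e < g q].
  have [le0|gt0] := leP 0 (left_envelope y - e).
    by apply: left_envelope_gt => //; rewrite ltrBlDr ltrDl.
  have [_ [q /andP[q0 qy] _]] := S_n0 y0; exists q; split => //.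
  apply: lt_le_trans gt0 _.
  have q01 : 0 < (ratr q : R) <= 1 by rewrite q0 (le_trans (ltW qy)).
  by have /andP[] := g01 q01.
near=> z.
have qz : ratr q < z by near: z; exact: nbhs_left_gt.
have zy : z < y by near: z; exact: nbhs_left_lt.
have le1 : left_envelope z <= left_envelope y.
  exact: left_envelope_mono (ltW (lt_trans q0 qz)) (ltW zy) y1.
have le2 : g q <= left_envelope z by apply: left_envelope_ge => //; rewrite (le_trans (ltW zy)).
by rewrite ger0_norm ?subr_ge0//; move: eq le2; lra.
Unshelve. all: by end_near. Qed.

End left_envelope.

Lemma cdf_id (R : realType) : Defs.cdf (fun y : R => y).
Proof. by split => // y _; exact: cvg_at_left_filter. Qed.

Section copula_densities.
Variables (R : realType) (F : R -> R -> R).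
Hypothesis cF : copula F.
Local Notation lambda := (@lebesgue_measure R).

(** Off the null set where one of the countably many densities at rational
    heights is not the right derivative, the difference quotients of F pass
    their bounds to the limit: they are at most one because F is 1-Lipschitz in
    x, and they increase with the height by the rectangle inequality. *)
Lemma copula_densities : exists (f : rat -> R -> R) (N : set (measurableTypeR R)),
  [/\ measurable N, lambda N = 0%E,
      forall q, 0 < (ratr q : R) <= 1 ->
        [/\ measurable_fun [set: measurableTypeR R] (f q), forall x, 0 <= f q x &
            forall a b, 0 <= a -> a <= b -> b <= 1 ->
          (\int[lambda]_(x in `]a, b]) (f q x)%:E = (F b (ratr q) - F a (ratr q))%:E)%E],
      forall x, ~ N x -> forall q, 0 < (ratr q : R) <= 1 -> 0 <= f q x <= 1 &
      forall x, ~ N x -> forall q q', 0 < (ratr q : R) -> q <= q' -> (ratr q' : R) <= 1 ->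
        f q x <= f q' x].
Proof.
have dens (q : rat) : exists d : R -> R, 0 < (ratr q : R) <= 1 ->
  [/\ measurable_fun [set: measurableTypeR R] d, forall x, 0 <= d x,
      forall a b, 0 <= a -> a <= b -> b <= 1 ->
        (\int[lambda]_(x in `]a, b]) (d x)%:E = (F b (ratr q) - F a (ratr q))%:E)%E &
      {ae lambda, forall x,
        (F (clip (x + t)) (ratr q) - F (clip x) (ratr q)) / t @[t --> 0^'+] --> d x}].
  have [/andP[q0 q1]|nq] := pselect (0 < (ratr q : R) <= 1).
    by have [d dP] := copula_density cF q0 q1; exists d.
  by exists (fun=> 0).
have [f fP] := choice dens.
pose bad (q : rat) := if 0 < (ratr q : R) <= 1 then
  [set x : measurableTypeR R | ~ ((F (clip (x + t)) (ratr q) - F (clip x) (ratr q)) / t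
    @[t --> 0^'+] --> f q x)] else set0.
have badN q : lambda.-negligible (bad q).
  rewrite /bad; case: ifPn => [q01|_]; last exact: negligible_set0.
  by have [_ _ _ [N [mN N0 sub]]] := fP q q01; exists N.
have [N [mN N0 badsub]] : lambda.-negligible
    (\bigcup_n if unpickle n is Some q then bad q else set0).
  apply: negligible_bigcup => n; case: (unpickle n) => [q|]; [exact: badN|exact: negligible_set0].
have good x q : ~ N x -> 0 < (ratr q : R) <= 1 ->
    (F (clip (x + t)) (ratr q) - F (clip x) (ratr q)) / t @[t --> 0^'+] --> f q x.
  move=> Nx q01; apply: contrapT => nc; apply: Nx; apply: badsub.
  exists (pickle q); first exact: I.
  have -> : @unpickle rat (pickle q) = Some q by exact: pickleK.
  by rewrite /bad q01.
exists f, N; split => //.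
- by move=> q q01; have [] := fP q q01.
- move=> x Nx q q01; have /andP[q0 q1] := q01.
  have [_ -> _ _]/= := fP q q01.
  have H : 1 - (F (clip (x + t)) (ratr q) - F (clip x) (ratr q)) / t @[t --> 0^'+]
      --> 1 - f q x by apply: cvgB; [exact: cvg_cst|exact: good].
  rewrite -subr_ge0.
  apply: (@closed_cvg _ _ _ _ _ (fun t : R => 0 <= t) _ _ _ H); first exact: closed_ge.
  near=> t; have t0 : 0 < t by near: t; exact: nbhs_right_gt.
  rewrite /= subr_ge0 ler_pdivrMr// mul1r.
  have xt : x <= x + t by rewrite lerDl ltW.
  have /andP[c0 c1] := clip01 x; have /andP[c0' c1'] := clip01 (x + t).
  apply: (le_trans (copula_lip_x cF c0 (clip_mono xt) c1' q1)).
  by apply: le_trans (clip_lip xt) _; rewrite addrAC subrr add0r.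
- move=> x Nx q q' q0 qq' q'1.
  have qq'R : (ratr q : R) <= ratr q' by rewrite ler_rat.
  have q01 : 0 < (ratr q : R) <= 1 by rewrite q0 (le_trans qq'R).
  have q'01 : 0 < (ratr q' : R) <= 1 by rewrite q'1 (lt_le_trans q0).
  have H := cvgB (good x q' Nx q'01) (good x q Nx q01).
  rewrite -subr_ge0.
  apply: (@closed_cvg _ _ _ _ _ (fun t : R => 0 <= t) _ _ _ (H _)); first exact: closed_ge.
  near=> t; have t0 : 0 < t by near: t; exact: nbhs_right_gt.
  have xt : x <= x + t by rewrite lerDl ltW.
  rewrite /= subr_ge0 ler_wpM2r ?invr_ge0 ?(ltW t0)//.
  exact: copula_rect_le (clip_mono xt) qq'R.
Unshelve. all: by end_near. Qed.

End copula_densities.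

(** * The limit permutation of a copula *)

Section limit_of_copula.
Variables (R : realType) (F : R -> R -> R).
Hypothesis cF : copula F.
Local Notation lambda := (@lebesgue_measure R).

Section fixed_densities.
Variables (f : rat -> R -> R) (N1 : set (measurableTypeR R)).
Hypothesis f_dens : forall q, 0 < (ratr q : R) <= 1 ->
  [/\ measurable_fun [set: measurableTypeR R] (f q), forall x, 0 <= f q x &
      forall a b, 0 <= a -> a <= b -> b <= 1 ->
        (\int[lambda]_(x in `]a, b]) (f q x)%:E = (F b (ratr q) - F a (ratr q))%:E)%E].
Hypothesis f01 : forall x, ~ N1 x -> forall q, 0 < (ratr q : R) <= 1 -> 0 <= f q x <= 1.
Hypothesis f_mono : forall x, ~ N1 x -> forall q q', 0 < (ratr q : R) -> q <= q' ->
  (ratr q' : R) <= 1 -> f q x <= f q' x.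

Section fixed_null_set.
Variable N : set (measurableTypeR R).
Hypotheses (mN : measurable N) (N0 : lambda N = 0%E) (N1N : N1 `<=` N).

(** On the null set N the uniform cdf replaces the envelope. *)
Definition patched_envelope (x y : R) : R :=
  if x \in (N : set R) then y else left_envelope (f^~ x) y.
Local Notation Z := patched_envelope.

Lemma cdf_patched x : Defs.cdf (Z x).
Proof.
have -> : Z x = if x \in (N : set R) then (fun y => y) else left_envelope (f^~ x).
  by apply/funext => y; rewrite /patched_envelope; case: ifP.
case: ifPn => [_|/negP Nx]; first exact: cdf_id.
have N1x : ~ N1 x by move=> /N1N Nx'; apply: Nx; exact/mem_set.
exact: cdf_left_envelope (f01 N1x).
Qed.

Let Z01 x y : 0 <= y <= 1 -> 0 <= Z x y <= 1.
Proof. exact: (cdf_itv (cdf_patched x)). Qed.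

(** Off N the value at (x, y) exceeds c >= 0 exactly if f q x > c for some
    rational q < y: a countable union of rectangles. *)
Lemma measurable_patched :
  measurable_fun ([set p | 0 <= p.1 <= 1 /\ 0 <= p.2 <= 1] :
    set (measurableTypeR R * measurableTypeR R)) (fun p => Z p.1 p.2).
Proof.
move=> mD; apply: (measurability _ (RGenOInfty.measurableE R)) => // _ [_ [c ->] <-].
set D := [set p | _] in mD *.
have [c0|c0] := ltP c 0.
  rewrite (_ : _ `&` _ = D)//; apply/seteqP; split => [p []//|p Dp]; split => //=.
  rewrite in_itv/= andbT; apply: lt_le_trans c0 _.
  by move: Dp => [_ p2]; have /andP[] := Z01 p.1 p2.
pose G (q : rat) : set (measurableTypeR R * measurableTypeR R) :=
  [set x | c < f q x] `*` [set y | ratr q < y].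
pose H n := if unpickle n is Some q then
  if 0 < (ratr q : R) <= 1 then G q else set0 else set0.
have mH n : measurable (H n).
  rewrite /H; case: (unpickle n) => // q; case: ifP => // q01; apply: measurableX.
    have [mf _ _] := f_dens q01.
    rewrite (_ : [set x | _] = f q @^-1` `]c, +oo[%classic); last first.
      by apply/seteqP; split => x /=; rewrite in_itv/= andbT.
    by rewrite -[X in measurable X]setTI; exact: mf.
  by rewrite (_ : [set y | _] = `]ratr q, +oo[%classic)//;
    apply/seteqP; split => x /=; rewrite in_itv/= andbT.
have -> : D `&` (fun p => Z p.1 p.2) @^-1` `]c, +oo[%classic =
    D `&` ((N `*` `]c, +oo[%classic) `|` ((~` N `*` setT) `&` \bigcup_n H n)).
  apply/seteqP; split => -[x y] [/= [x01 y01]]; rewrite !in_itv/= !andbT.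
    rewrite /patched_envelope; case: ifPn => [/set_mem Nx cy|/negP Nx cZ].
      by split => //; left; split => //=; rewrite in_itv/= andbT.
    split => //; right; split; first by split => // Nx'; apply: Nx; exact/mem_set.
    have [q [q0 qy cq]] := left_envelope_gt c0 cZ.
    exists (pickle q); first exact: I.
    rewrite /H (_ : @unpickle rat (pickle q) = Some q); last exact: pickleK.
    by case/andP: y01 => _ y1; rewrite q0 (le_trans (ltW qy) y1).
  move=> [[Nx]|[[Nx _] [n _ Hxy]]].
    by rewrite /= ?in_itv/= ?andbT => cy; split => //; rewrite /patched_envelope mem_set.
  split => //; rewrite /patched_envelope memNset//.
  move: Hxy; rewrite /H; case: (unpickle n) => // q; case: ifP => // /andP[q0 q1] [/= cq qy].
  have N1x : ~ N1 x by move=> /N1N.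
  apply: lt_le_trans cq _; case/andP: y01 => _ y1.
  by apply: left_envelope_ge q0 qy y1 => //; exact: f01 N1x.
apply: measurableI => //; apply: measurableU; first exact: measurableX.
apply: measurableI; first by apply: measurableX => //; exact: measurableC.
exact: bigcupT_measurable.
Qed.

Lemma measurable_patched_section y : 0 <= y <= 1 ->
  measurable_fun (`[0, 1]%classic : set (measurableTypeR R)) (Z ^~ y).
Proof.
move=> y01.
have mD : measurable ([set p | 0 <= p.1 <= 1 /\ 0 <= p.2 <= 1] :
    set (measurableTypeR R * measurableTypeR R)).
  rewrite (_ : [set p | _] = `[0, 1]%classic `*` `[0, 1]%classic); first exact: measurableX.
  by apply/seteqP; split => -[u v]; rewrite /= !in_itv/=.
apply: (@measurable_comp _ _ _ _ _ _ _ (fun p => Z p.1 p.2) _ (fun x => (x, y))).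
- exact: mD.
- by move=> _ [x x01 <-] /=; move: x01; rewrite /= in_itv.
- exact: measurable_patched.
- by apply: measurable_funTS; exact: measurable_pair2.
Qed.

(** Off N the patched function at height y lies between the densities at
    rational heights just below and just above y. Their integrals are close to
    the one claimed because F is Lipschitz in y. *)
Lemma integral_patched a b y : 0 <= a -> a <= b -> b <= 1 -> 0 <= y <= 1 ->
  (\int[lambda]_(x in `]a, b]) (Z x y)%:E = (F b y - F a y)%:E)%E.
Proof.
move=> a0 ab b1 y01.
have mab : measurable (`]a, b]%classic : set (measurableTypeR R)) by [].
have sub01 : `]a, b]%classic `<=` (`[0, 1]%classic : set R).
  move=> x; rewrite /= !in_itv/= => /andP[ax xb].
  by rewrite (le_trans a0 (ltW ax)) (le_trans xb).
have mZ : measurable_fun (`]a, b]%classic : set (measurableTypeR R)) (fun x => (Z x y)%:E).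
  apply/measurable_EFinP; apply: measurable_funS (measurable_patched_section y01) => //.
have aeN : {ae lambda, forall x, ~ N x}.
  by exists N; split => // x /= /contrapT.
have lower q : 0 < (ratr q : R) -> ratr q < y ->
    ((F b (ratr q) - F a (ratr q))%:E <= \int[lambda]_(x in `]a, b]) (Z x y)%:E)%E.
  move=> q0 qy; have y1 : y <= 1 by case/andP: y01.
  have q01 : 0 < (ratr q : R) <= 1 by rewrite q0 (le_trans (ltW qy)).
  have [mf f0 <-//] := f_dens q01.
  apply: ae_ge0_le_integral => //.
  - by move=> x _; rewrite lee_fin.
  - by apply/measurable_EFinP; exact: measurable_funTS.
  - by move=> x _; rewrite lee_fin; case/andP: (Z01 x y01).
  apply: filterS aeN.
  move=> x Nx _; rewrite lee_fin /patched_envelope memNset//.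
  have N1x : ~ N1 x by move=> /N1N.
  by apply: left_envelope_ge q0 qy y1; exact: f01 N1x.
have upper q : 0 < (ratr q : R) -> y <= ratr q -> (ratr q : R) <= 1 ->
    (\int[lambda]_(x in `]a, b]) (Z x y)%:E <= (F b (ratr q) - F a (ratr q))%:E)%E.
  move=> q0 yq q1.
  have q01 : 0 < (ratr q : R) <= 1 by rewrite q0.
  have [mf f0 <-//] := f_dens q01.
  apply: ae_ge0_le_integral => //.
  - by move=> x _; rewrite lee_fin; case/andP: (Z01 x y01).
  - by move=> x _; rewrite lee_fin.
  - by apply/measurable_EFinP; exact: measurable_funTS.
  apply: filterS aeN.
  move=> x Nx _; rewrite lee_fin /patched_envelope memNset//.
  have N1x : ~ N1 x by move=> /N1N.
  by apply: left_envelope_le yq q1 q0; [exact: f01 N1x|exact: f_mono N1x].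
have /andP[] := y01; rewrite le_eqVlt => /predU1P[y0 _|y0 y1].
  rewrite -y0 !(copulax0 cF) subrr integral0_eq// => x _.
  by rewrite (cdf0 (cdf_patched x)).
have a01 : 0 <= a <= 1 by rewrite a0 (le_trans ab).
have b01 : 0 <= b <= 1 by rewrite b1 (le_trans a0).
apply/eqP; rewrite eq_le; apply/andP; split; apply/lee_addgt0Pr => e e0.
- have [q [q0 yq q1 qe]] : exists q, [/\ 0 < (ratr q : R), y <= ratr q, (ratr q : R) <= 1 & ratr q <= y + e].
    move: y1; rewrite le_eqVlt => /predU1P[->|y1].
      by exists 1; rewrite rmorph1 ltr01 lexx lerDl ltW.
    have : y < Num.min 1 (y + e) by rewrite lt_min y1 ltrDl.
    move=> /rat_in_itvoo[q]; rewrite in_itv/= lt_min => /andP[yq /andP[q1 qe]].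
    by exists q; rewrite (lt_trans y0 yq) !ltW.
  apply: le_trans (upper q q0 yq q1) _; rewrite -EFinD lee_fin.
  have /andP[_ lb] := copula_lip_y cF b01 (ltW y0) yq q1.
  have /andP[la _] := copula_lip_y cF a01 (ltW y0) yq q1.
  by move: lb la qe; lra.
- have [q [q0 qy qe]] : exists q, [/\ 0 < (ratr q : R), ratr q < y & y - e <= ratr q].
    have : Num.max 0 (y - e) < y by rewrite gt_max y0 ltrBlDr ltrDl.
    move=> /rat_in_itvoo[q]; rewrite in_itv/= gt_max => /andP[/andP[q0 qe] qy].
    by exists q; rewrite q0 qy ltW.
  apply: (@le_trans _ _ ((F b (ratr q) - F a (ratr q))%:E + e%:E)%E).
    rewrite -EFinD lee_fin.
    have /andP[_ lb] := copula_lip_y cF b01 (ltW q0) (ltW qy) y1.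
    have /andP[la _] := copula_lip_y cF a01 (ltW q0) (ltW qy) y1.
    by move: lb la qe; lra.
  by apply: leeD2r; exact: lower.
Qed.

End fixed_null_set.
End fixed_densities.
End limit_of_copula.

(** Markov's inequality for functions w n whose integrals tend to 0. *)
Lemma null_of_integral_bounds (R : realType) (A : set (measurableTypeR R)) (c : R)
    (w : nat -> R -> R) :
  measurable A -> 0 < c -> (forall n x, `]0, 1]%classic x -> 0 <= w n x) ->
  (forall n x, A x -> `]0, 1]%classic x /\ c <= w n x) ->
  (forall n, (\int[lebesgue_measure]_(x in `]0%R, 1%R]) (w n x)%:E <= (n.+1%:R^-1)%:E)%E) ->
  lebesgue_measure A = 0%E.
Proof.
move=> mA c0 w0 Aw int_w; apply/eqP; rewrite -measure_le0.
apply/lee_addgt0Pr => e e0; rewrite add0e.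
have bound n : (c%:E * lebesgue_measure A <= (n.+1%:R^-1 : R)%:E)%E.
  apply: le_trans (int_w n); rewrite -integral_cst// integral_mkcond.
  rewrite [leRHS]integral_mkcond; apply: le_lower_integral => x _.
    by rewrite patchE; case: ifP => // _; rewrite lee_fin ltW.
  rewrite !patchE; case: ifPn => [/set_mem/(Aw n)[x01 cw]|_].
    by rewrite mem_set// lee_fin.
  by case: ifPn => // /set_mem x01; rewrite lee_fin w0.
have ce0 : 0 < c * e by rewrite mulr_gt0.
have [n ne] := exists_natSinv_lt ce0.
have := bound n; rewrite -lee_pdivlMl// => /le_trans; apply.
by rewrite -EFinM lee_fin ler_pdivrMl// ltW.
Qed.

Section limit_permutation_of_copula.
Variables (R : realType) (F : R -> R -> R).
Hypothesis cF : copula F.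
Local Notation lambda := (@lebesgue_measure R).

(** The envelope Z1 of the densities may fail to reach 1 at height 1, or to tend
    to 0 at height 0, only for x in a null set: the integral of Z1(., 1) is 1,
    and that of Z1(., 1 / n) is 1 / n. So these x join the set N where the
    uniform cdf is used. *)
Lemma copula_limit_permutation : exists Z : R -> R -> R,
  [/\ limit_permutation Z,
      forall y, 0 <= y <= 1 ->
        measurable_fun (`[0, 1]%classic : set (measurableTypeR R)) (Z ^~ y) &
      forall a b y, 0 <= a -> a <= b -> b <= 1 -> 0 <= y <= 1 ->
        (\int[lambda]_(x in `]a, b]) (Z x y)%:E = (F b y - F a y)%:E)%E].
Proof.
have [f [N1 [mN1 N10 f_dens f01 f_mono]]] := copula_densities cF.
have sub01 : `]0, 1]%classic `<=` (`[0, 1]%classic : set R).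
  by move=> x; rewrite /= !in_itv/= => /andP[/ltW-> ->].
pose Z1 := patched_envelope f N1.
have Z1cdf x : Defs.cdf (Z1 x) by exact: (cdf_patched f01 (fun x => id)).
have Z101 x y : 0 <= y <= 1 -> 0 <= Z1 x y <= 1 by exact: (cdf_itv (Z1cdf x)).
have Z1int := integral_patched cF f_dens f01 f_mono mN1 N10 (fun x => id).
have mZ1 := measurable_patched_section f_dens f01 mN1 (fun x => id).
have one01 : 0 <= (1 : R) <= 1 by rewrite ler01 lexx.
have inv01 n : 0 <= (n.+1%:R^-1 : R) <= 1.
  by rewrite invr_ge0 ler0n invf_le1// ler1n.
have meas_ge y c : 0 <= y <= 1 -> measurable (`]0, 1]%classic `&` [set x | c <= Z1 x y] :
    set (measurableTypeR R)).
  move=> y01.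
  have m : measurable_fun (`]0, 1]%classic : set (measurableTypeR R)) (Z1 ^~ y).
    exact: measurable_funS (mZ1 y y01).
  rewrite (_ : [set x | _] = (Z1 ^~ y) @^-1` `[c, +oo[%classic); first exact: m.
  by apply/seteqP; split => x /=; rewrite in_itv/= andbT.
have meas_le y c : 0 <= y <= 1 -> measurable (`]0, 1]%classic `&` [set x | Z1 x y <= c] :
    set (measurableTypeR R)).
  move=> y01.
  have m : measurable_fun (`]0, 1]%classic : set (measurableTypeR R)) (Z1 ^~ y).
    exact: measurable_funS (mZ1 y y01).
  rewrite (_ : [set x | _] = (Z1 ^~ y) @^-1` `]-oo, c]%classic); first exact: m.
  by apply/seteqP; split => x /=; rewrite in_itv.
(* The x where Z1 misses 1 by at least 1 / j.+1, and those where it stays at least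
   1 / j.+1 near height 0. *)
pose A j : set (measurableTypeR R) :=
  `]0, 1]%classic `&` [set x | Z1 x 1 <= 1 - j.+1%:R^-1].
pose B j : set (measurableTypeR R) :=
  \bigcap_n (`]0, 1]%classic `&` [set x | j.+1%:R^-1 <= Z1 x n.+1%:R^-1]).
have mA j : measurable (A j) by exact: meas_le.
have mB j : measurable (B j) by apply: bigcapT_measurable => n; exact: meas_ge.
have j0 (j : nat) : 0 < (j.+1%:R^-1 : R) by rewrite invr_gt0.
have intA : (\int[lambda]_(x in `]0%R, 1%R]) (1 - Z1 x 1)%:E = 0)%E.
  have Zint : (\int[lambda]_(x in `]0%R, 1%R]) (Z1 x 1)%:E = 1%E)%E.
    by rewrite Z1int// (copula0y cF) (copula1y cF)// subr0.
  have mZ11 : measurable_fun (`]0, 1]%classic : set (measurableTypeR R)) (fun x => Z1 x 1).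
    exact: measurable_funS (mZ1 1 one01).
  have : (\int[lambda]_(x in `]0%R, 1%R]) (Z1 x 1)%:E +
          \int[lambda]_(x in `]0%R, 1%R]) (1 - Z1 x 1)%:E = 1%E)%E.
    rewrite -ge0_integralD//.
    - under eq_integral do rewrite -EFinD addrC subrK.
      by rewrite integral_cst//= lebesgue_measure_itv/= lte_fin ltr01 oppr0 adde0 mul1e.
    - by move=> x _; rewrite lee_fin; case/andP: (Z101 x 1 one01).
    - exact/measurable_EFinP.
    - by move=> x _; rewrite lee_fin subr_ge0; case/andP: (Z101 x 1 one01).
    - by apply/measurable_EFinP; apply: measurable_funB.
  rewrite Zint; case: (\int[_]_(_ in _) _)%E => [r| |]//=; rewrite -EFinD => -[E].
  by congr EFin; lra.
have A0 j : lambda (A j) = 0%E.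
  apply: (@null_of_integral_bounds _ _ j.+1%:R^-1 (fun _ x => 1 - Z1 x 1)) => //.
  - by move=> _ x _; rewrite subr_ge0; case/andP: (Z101 x 1 one01).
  - by move=> _ x [x01 /= Zx]; split => //; move: Zx; move: (j.+1%:R^-1) => i; lra.
  - by move=> n; rewrite intA lee_fin ltW.
have B0 j : lambda (B j) = 0%E.
  apply: (@null_of_integral_bounds _ _ j.+1%:R^-1 (fun n x => Z1 x n.+1%:R^-1)) => //.
  - by move=> n x _; case/andP: (Z101 x _ (inv01 n)).
  - by move=> n x /(_ n I)[].
  - by move=> n; rewrite Z1int// (copula0y cF) (copula1y cF)// subr0.
(* 0 is in N because A j and B j only see the x > 0. *)
pose N : set (measurableTypeR R) := N1 `|` [set 0] `|` \bigcup_j (A j `|` B j).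
have mN : measurable N.
  apply: measurableU; first exact: measurableU.
  by apply: bigcupT_measurable => j; exact: measurableU.
have N0 : lambda N = 0%E.
  apply/negligibleP => //; apply: negligibleU.
    by apply: negligibleU; apply/negligibleP => //; exact: lebesgue_measure_set1.
  apply: negligible_bigcup => j; apply: negligibleU; apply/negligibleP.
  - exact: mA.
  - exact: A0.
  - exact: mB.
  - exact: B0.
have N1N : N1 `<=` N by move=> x Nx; left; left.
pose Z := patched_envelope f N.
have Zcdf x : Defs.cdf (Z x) by exact: (cdf_patched f01 N1N).
have Z01 x y : 0 <= y <= 1 -> 0 <= Z x y <= 1 by exact: (cdf_itv (Zcdf x)).
have Zint := integral_patched cF f_dens f01 f_mono mN N0 N1N.
have mZ := measurable_patched_section f_dens f01 mN N1N.
have ZN x y : N x -> Z x y = y by move=> Nx; rewrite /Z /patched_envelope mem_set.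
have ZZ1 x y : ~ N x -> Z x y = Z1 x y.
  by move=> Nx; rewrite /Z /Z1 /patched_envelope !memNset// => /N1N.
have notN x : ~ N x -> 0 <= x <= 1 -> `]0, 1]%classic x.
  move=> Nx /andP[x0 x1]; rewrite /= in_itv/= x1 andbT lt_neqAle x0 andbT.
  by apply/eqP => x0'; apply: Nx; left; right.
exists Z; split; [split| exact: mZ | exact: Zint].
- have mp := measurable_patched f_dens f01 mN N1N.
  move=> _ Y mY; apply: caratheodory_measurable_mu_ext; apply: mp => //.
  rewrite (_ : [set p | _] = `[0, 1]%classic `*` `[0, 1]%classic); first exact: measurableX.
  by apply/seteqP; split => -[u v]; rewrite /= !in_itv/=.
- by move=> x _; exact: Zcdf.
- move=> x x01; rewrite (cdf0 (Zcdf x)).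
  apply/cvgrPdist_lt => e e0.
  have [Nx|Nx] := pselect (N x).
    near=> y; rewrite ZN// sub0r normrN ger0_norm; last first.
      by near: y; exact: nbhs_right_ge.
    by near: y; exact: nbhs_right_lt.
  have [j je] := exists_natSinv_lt e0.
  have xoc := notN x Nx x01.
  have [n Zn] : exists n, Z1 x n.+1%:R^-1 < j.+1%:R^-1.
    apply: contrapT => /forallNP H; apply: Nx; right; exists j => //; right => n _.
    split => //.
    by rewrite /= leNgt; apply/negP; exact: H.
  near=> y.
  have y0 : 0 <= y by near: y; exact: nbhs_right_ge.
  have yn : y <= n.+1%:R^-1 by near: y; apply: nbhs_right_le; exact: j0.
  have y01 : 0 <= y <= 1 by rewrite y0 (le_trans yn)//; case/andP: (inv01 n).
  rewrite sub0r normrN ger0_norm; last by case/andP: (Z01 x y y01).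
  rewrite ZZ1//; apply: le_lt_trans je; apply: le_trans (ltW Zn).
  by apply: (Defs.cdf_nondecreasing (Z1cdf x)) => //; case/andP: (inv01 n).
- move=> x x01; have [Nx|Nx] := pselect (N x); first by rewrite ZN.
  rewrite ZZ1//; apply/eqP; rewrite eq_le; apply/andP; split.
    by case/andP: (Z101 x 1 one01).
  apply/ler_addgt0Pr => e e0.
  have [j je] := exists_natSinv_lt e0.
  have [|Zj] := leP (Z1 x 1) (1 - j.+1%:R^-1).
    have xoc := notN x Nx x01.
    by move=> Zj; exfalso; apply: Nx; right; exists j => //; left; split.
  by move: Zj je; move: (j.+1%:R^-1) => i; lra.
- move=> y y01.
  have mZy : measurable_fun (`[0, 1]%classic : set (measurableTypeR R)) (EFin \o Z ^~ y).
    by apply/measurable_EFinP; exact: mZ.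
  transitivity (\int[lambda]_(x in `[0%R, 1%R]) (Z x y)%:E)%E.
    rewrite integral_mkcond [RHS]integral_mkcond.
    rewrite -ge0_integral_completed_lebesgue//.
      by apply: (measurable_restrictT _ _).1.
    move=> x; rewrite patchE; case: ifP => // _.
    by rewrite lee_fin; case/andP: (Z01 x y y01).
  rewrite -integral_itv_obnd_cbnd; last by apply: measurable_funS mZy.
  by rewrite Zint// (copula0y cF) (copula1y cF)// subr0.
Unshelve. all: by end_near. Qed.

End limit_permutation_of_copula.

(** * Every convergent sequence has a limit *)

Section masses_of_copula.
Variables (R : realType) (F Z : R -> R -> R).
Local Notation lambda := (@lebesgue_measure R).
Hypotheses (Zlim : limit_permutation Z)
  (mZ : forall y, 0 <= y <= 1 ->
    measurable_fun (`[0, 1]%classic : set (measurableTypeR R)) (Z ^~ y))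
  (Zint : forall a b y, 0 <= a -> a <= b -> b <= 1 -> 0 <= y <= 1 ->
    (\int[lambda]_(x in `]a, b]) (Z x y)%:E = (F b y - F a y)%:E)%E).

Lemma cell_masses_copula k (p : 'I_k.+1 * 'I_k.+1 -> R) c :
  cell_masses Z p -> p c = rect_diff F c.
Proof.
move=> pZ; apply/EFin_inj.
have grid01 (b : nat) : (b <= k.+1)%N -> 0 <= (b%:R / k.+1%:R : R) <= 1.
  by move=> bk; rewrite divr_ge0//= ler_pdivrMr// mul1r ler_nat.
have y1 := grid01 c.2 (ltnW (ltn_ord c.2)).
have y2 := grid01 c.2.+1 (ltn_ord c.2).
have /andP[a0 _] := grid01 c.1 (ltnW (ltn_ord c.1)).
have /andP[_ b1] := grid01 c.1.+1 (ltn_ord c.1).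
set a := c.1%:R / _ in a0; set b := c.1.+1%:R / _ in b1.
have ab : a < b by rewrite ltr_pM2r ?invr_gt0// ltr_nat.
pose g x := Z x (c.2.+1%:R / k.+1%:R) - Z x (c.2%:R / k.+1%:R).
have mg : measurable_fun (`[0, 1]%classic : set (measurableTypeR R)) g.
  by apply: measurable_funB; exact: mZ.
have g0 x : 0 <= x <= 1 -> 0 <= g x.
  move=> x01; rewrite subr_ge0.
  apply: (Defs.cdf_nondecreasing (limit_permutation_cdf Zlim x01)).
  - by case/andP: y1.
  - by rewrite ler_pM2r ?invr_gt0// ler_nat.
  - by case/andP: y2.
have cell01 : cell k c.1 `<=` (`[0, 1]%classic : set R).
  by move=> x xc; rewrite /= in_itv/=; apply: cell_sub01 xc; rewrite -ltnS ltn_ord.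
have oc01 : `]a, b]%classic `<=` (`[0, 1]%classic : set R).
  move=> x; rewrite /= !in_itv/= => /andP[ax xb].
  by rewrite (le_trans a0 (ltW ax)) (le_trans xb).
have sliceE : (fun x => (cell_slice Z c x)%:E) = (EFin \o g) \_ (cell k c.1).
  apply/funext => x; rewrite patchE /cell_slice indicE.
  by case: ifP => _; rewrite ?mul1r ?mul0r.
have mcell := @measurable_cell R k c.1.
have pE : (p c)%:E = (\int[lambda]_(x in cell k c.1) (g x)%:E)%E.
  rewrite [RHS]integral_mkcond -sliceE -ge0_integral_completed_lebesgue.
  - rewrite -(big_pred1_eq +%R c p).
    by rewrite -(integral_cell_masses (h := cell_slice Z c) pZ)// => x; rewrite big_pred1_eq.
  - rewrite sliceE; apply: (measurable_restrictT _ _).1 => //.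
    by apply/measurable_EFinP; exact: measurable_funS mg.
  - move=> x; rewrite lee_fin; apply: cell_slice_ge0.
    exact: limit_permutation_cdf Zlim.
rewrite pE.
have -> : (\int[lambda]_(x in cell k c.1) (g x)%:E = \int[lambda]_(x in `]a, b]) (g x)%:E)%E.
  have moo : measurable_fun (`]a, b[%classic : set (measurableTypeR R)) (EFin \o g).
    apply/measurable_EFinP; apply: measurable_funS mg => // x; rewrite /= !in_itv/=.
    by move=> /andP[ax xb]; rewrite (le_trans a0 (ltW ax)) (le_trans (ltW xb)).
  by rewrite /cell -/a -/b (integral_itv_bndoo _ _ moo) [RHS](integral_itv_bndoo _ _ moo).
have sum_int : (\int[lambda]_(x in `]a, b]) (Z x (c.2%:R / k.+1%:R))%:E +
    \int[lambda]_(x in `]a, b]) (g x)%:E =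
    \int[lambda]_(x in `]a, b]) (Z x (c.2.+1%:R / k.+1%:R))%:E)%E.
  rewrite -ge0_integralD//.
  - by apply: eq_integral => x _; rewrite -EFinD addrC subrK.
  - move=> x /oc01; rewrite /= in_itv/= => x01; rewrite lee_fin.
    by case/andP: (cdf_itv (limit_permutation_cdf Zlim x01) y1).
  - by apply/measurable_EFinP; apply: measurable_funS (mZ y1).
  - by move=> x /oc01; rewrite /= in_itv/= => x01; rewrite lee_fin g0.
  - by apply/measurable_EFinP; apply: measurable_funS mg.
move: sum_int; rewrite !Zint ?(ltW ab)//.
case: (\int[_]_(_ in _) _)%E => [r| |]//=; rewrite -EFinD => -[E].
by congr EFin; rewrite /rect_diff -/a -/b; lra.
Qed.

End masses_of_copula.

Section limit_of_permutations.
Variable R : realType.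

(** Along the ultrafilter the cell frequencies on every grid tend to the cell
    masses of Z, so the limit l of the densities is within a multiple of
    1 / k.+1 of t(tau, Z), for every k. *)
Lemma density_limit_exists (sigma : nat -> permutation) :
  convergent R sigma -> plength (sigma n) @[n --> \oo] --> \oo ->
  exists Z : R -> R -> R, limit_permutation Z /\
    forall tau : permutation,
      density R tau (sigma n) @[n --> \oo] --> limit_density tau Z.
Proof.
move=> sigma_cvg sigma_oo.
have [U [PU ooU [F cF FP]]] := copula_ultralimit R sigma_oo.
have [Z [Zlim mZ Zint]] := copula_limit_permutation cF.
exists Z; split => // tau; have := sigma_cvg tau.
set l := lim _ => dl; suff <- : l = limit_density tau Z by [].
have dlU : density R tau (sigma n) @[n --> U] --> l.
  by move=> A /dl /ooU.
have C0 : 0 <= density_bound R tau by rewrite addr_ge0// mulr_ge0.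
have close k : `|l - limit_density tau Z| <= density_bound R tau * k.+1%:R^-1.
  have [p pZ] := cell_masses_exist k Zlim.
  have H : `|density R tau (sigma n) - limit_density tau Z| @[n --> U] -->
      `|l - limit_density tau Z|.
    by apply: cvg_norm; apply: cvgB => //; exact: cvg_cst.
  apply: (@closed_cvg _ _ U _ _ (fun t : R => t <= density_bound R tau * k.+1%:R^-1)
    _ _ _ H); first exact: closed_le.
  have large M : \forall n \near U, (M <= plength (sigma n))%N.
    by apply: ooU; move: sigma_oo => /cvgnyPge; exact.
  have dist0 : \sum_c `|cell_freq R (@grid_colour (sigma n) k) (@grid_colour (sigma n) k) c - p c|
      @[n --> U] --> (0 : R).
    rewrite -[X in _ --> X](@big1_eq _ _ +%R _ (index_enum ('I_k.+1 * 'I_k.+1)%type) xpredT).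
    apply: cvg_big => [|c _]; first exact: add_continuous.
    have pc := cell_masses_copula Zlim mZ Zint c pZ.
    have -> : (0 : R) = `|p c - p c| by rewrite subrr normr0.
    apply: cvg_norm; apply: cvgB; last exact: cvg_cst.
    rewrite pc; under eq_fun do rewrite cell_freq_grid.
    by apply: cvgD; [apply: cvgB; [apply: cvgB|]|]; exact: FP.
  have k0 : 0 < (k.+1%:R^-1 : R) by rewrite invr_gt0.
  near=> n.
  apply: (density_close (limit_permutation_cdf Zlim) (limit_permutation1 Zlim) pZ
    (fun a => cell_masses_row a Zlim pZ) (fun b => cell_masses_col b Zlim pZ)
    (@grid_colour_mono (sigma n) k) (@grid_colour_mono (sigma n) k)) => //.
  - by near: n; exact: large.
  - rewrite lef_pV2 ?posrE// ler_nat; near: n; exact: large.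
  - near: n; move: dist0 => /cvgrPdist_le/(_ _ k0); apply: filterS => n.
    by rewrite sub0r normrN ger0_norm// sumr_ge0.
apply/eqP; rewrite -subr_eq0 -normr_le0; apply/ler_addgt0Pr => e e0; rewrite add0r.
have e'0 : 0 < e / (density_bound R tau + 1) by rewrite divr_gt0// ltr_wpDl.
have [k ke] := exists_natSinv_lt e'0.
apply: le_trans (close k) _; move: ke; rewrite ltr_pdivlMr ?ltr_wpDl//.
have : 0 <= (k.+1%:R^-1 : R) by rewrite invr_ge0.
by move: (k.+1%:R^-1) => i; nra.
Unshelve. all: by end_near. Qed.

End limit_of_permutations.

Theorem theorem1p4 (R : realType) :
  (forall sigma : nat -> permutation,
     convergent R sigma ->
     plength (sigma n) @[n --> \oo] --> \oo ->
     exists Z : R -> R -> R, limit_permutation Z /\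
       forall tau : permutation,
         density R tau (sigma n) @[n --> \oo] --> limit_density tau Z)
  /\
  (forall Z : R -> R -> R,
     limit_permutation Z ->
     exists sigma : nat -> permutation, convergent R sigma /\
       forall tau : permutation,
         density R tau (sigma n) @[n --> \oo] --> limit_density tau Z).
Proof.
split; first exact: density_limit_exists.
move=> Z /limit_permutation_is_limit[sigma sigmaP]; exists sigma; split => //.
by move=> tau; apply/cvg_ex; exists (limit_density tau Z).
Qed.
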